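(* Suppose $k\ge 2$ and $n\ge 1$. Then \[ \mathrm{ex}(n,\mathcal{C}^{\mathrm{even}}_{2k}\cup\mathcal{C}_k)\le \tfrac12 n^{1+1/k}+\tfrac{k-1}{2k}n+n^{1-1/k}. \] Furthermore, if $k\in\{2,3,5\}$, then for infinitely many $n$, \[ \mathrm{ex}(n,\mathcal{C}^{\mathrm{even}}_{2k}\cup\mathcal{C}_k)\ge \tfrac12 n^{1+1/k}+\tfrac{k-1}{2k}n-n^{1-1/k}. \]
   Context: Graphs are finite and simple. $\mathcal{C}^{\mathrm{even}}_{2k}=\{C_4,C_6,\dots,C_{2k}\}$ (even cycles of length at most $2k$) and $\mathcal{C}_k=\{C_3,C_4,\dots,C_k\}$ (cycles of length at most $k$). For a family $\mathcal{F}$ of graphs, a graph is $\mathcal{F}$-free if it contains no subgraph isomorphic to a member of $\mathcal{F}$, and the Turán number $\mathrm{ex}(n,\mathcal{F})$ is the maximum number of edges in an $\mathcal{F}$-free graph on $n$ vertices. *)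

(* Defs.v *)
From mathcomp Require Import all_boot all_order all_algebra.
From mathcomp Require Import all_classical all_reals all_analysis.

Set Implicit Arguments.
Unset Strict Implicit.
Unset Printing Implicit Defensive.

Local Open Scope classical_set_scope.

(* A finite simple graph on the vertex set 'I_n is its set of edges, an edge
   being a two-element set of vertices. *)
Definition sgraph (n : nat) : Type :=
  {E : {set {set 'I_n}} | [forall e in E, #|e| == 2]}.

Definition edges (n : nat) (G : sgraph n) : {set {set 'I_n}} := sval G.

(* G has a subgraph isomorphic to H: the image of H under some injection of
   the vertices is a graph isomorphic to H whose edges are all edges of G. *)
Definition contains (n m : nat) (G : sgraph n) (H : sgraph m) : Prop :=
  exists f : 'I_m -> 'I_n,
    injective f /\ [set f @: (e : {set 'I_m}) | e in edges H]%SET \subset edges G.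

Definition graph_family : Type := set {m : nat & sgraph m}.

Definition family_free (F : graph_family) (n : nat) (G : sgraph n) : Prop :=
  forall H : {m : nat & sgraph m}, F H -> ~ contains G (projT2 H).

(* The value is 0 when there is no F-free graph on n vertices, which can only
   happen if F has an edgeless member. *)
Definition ex (n : nat) (F : graph_family) : nat :=
  \max_(G : sgraph n | `[< family_free F G >]) #|edges G|.

(* The cardinality filter removes the loop and keeps the definition total for
   m <= 2; for m >= 3 it is redundant and this is the usual cycle C_m. *)
Definition cycle_edges (m : nat) : {set {set 'I_m}} :=
  [set e : {set 'I_m} | (#|e| == 2)
     && [exists i : 'I_m, e == [set i; ordS i]%SET]]%SET.

Lemma cycle_edges_card2 (m : nat) : [forall e in cycle_edges m, #|e| == 2].
Proof. by apply/forall_inP => e; rewrite inE => /andP[]. Qed.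

Definition cycle_graph (m : nat) : sgraph m :=
  exist _ (cycle_edges m) (cycle_edges_card2 m).

Definition cycle_member (m : nat) : {m : nat & sgraph m} :=
  existT _ m (cycle_graph m).

(* {C_4, C_6, ..., C_(2k)} *)
Definition even_cycles (k : nat) : graph_family :=
  [set cycle_member (2 * i) | i in [set i : nat | (2 <= i <= k)%N]].

(* {C_3, C_4, ..., C_k} *)
Definition short_cycles (k : nat) : graph_family :=
  [set cycle_member i | i in [set i : nat | (3 <= i <= k)%N]].

(* Main.v *)
(* Upper bound. If a graph has no cycle of length at most k and no even cycle
   of length at most 2k, then two non-backtracking walks of length k with the
   same ends coincide: otherwise the part where they differ is a closed
   non-backtracking walk of even length at most 2k, and a repeated vertex cuts
   it into two closed walks one of which has length at most k. So there are at
   most n^2 such walks. On the other hand, when the minimum degree is at least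
   2, concavity of ln along the walk together with convexity of x ln (x - 1)
   on [2, +oo[ (Alon, Hoory, Linial) yields n d (d - 1)^(k-1) walks for the
   average degree d. Vertices of degree at most 1 are removed by induction.

   Lower bound. The extremal graphs are the polarity graphs of self-polar
   generalized (k+1)-gons, in coordinates: a q-ary tree of depth k (the vertices
   are the words of length at most k over F_q), plus a symmetric relation on the
   leaves. Seen from its visits to the leaves at even times, a closed
   non-backtracking walk of even length at most 2k is a closed chain of jumps
   in directions of the projective line, two consecutive directions being
   distinct. A jump of height h moves a leaf within the h-th osculating space
   at its direction of a line (k = 2), a conic (k = 3) or a twisted cubic
   (k = 5, with an additional symplectic coordinate), and general position of
   these spaces excludes chains of total height at most k. *)

Require Import Defs.
From mathcomp Require Import all_boot all_order all_algebra.
From mathcomp Require Import all_classical all_reals all_analysis.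
From mathcomp Require Import zify ring lra.
From mathcomp Require finfield.

Set Implicit Arguments.
Unset Strict Implicit.
Unset Printing Implicit Defensive.

Import Order.TTheory GRing.Theory Num.Theory.
Import numFieldNormedType.Exports.

(** * Non-backtracking walks and short cycles *)

Definition has_cycle (T : Type) (e : rel T) (m : nat) : Prop :=
  exists f : 'I_m -> T, injective f /\ forall i, e (f i) (f (ordS i)).

Definition nb_walk (T : eqType) (e : rel T) (x : nat -> T) (l : nat) : Prop :=
  (forall i, i < l -> e (x i) (x i.+1)) /\
  (forall i, i.+1 < l -> x i != x i.+2).

(** A periodic sequence on all of [nat], so that non-backtracking covers the base point and the walk
    may be started anywhere. *)
Definition nb_closed (T : eqType) (e : rel T) (x : nat -> T) (l : nat) : Prop :=
  [/\ forall i, x (i + l) = x i, forall i, e (x i) (x i.+1)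
    & forall i, x i != x i.+2].

Definition forbidden (k m : nat) : bool :=
  (3 <= m <= k) || [&& 4 <= m, m <= 2 * k & ~~ odd m].

Section NonBacktracking.

Variables (T : eqType) (e : rel T).
Implicit Types (x y : nat -> T).

Lemma cycle_of_injective x m : 0 < m ->
  (forall i, i < m -> e (x i) (x i.+1)) -> x m = x 0 ->
  (forall i j, i < j -> j < m -> x i <> x j) -> has_cycle e m.
Proof.
move=> m0 xe xm xi; exists (fun i : 'I_m => x i); split.
  move=> i j xij; apply/val_inj/eqP => /=.
  have [ij|ji|//] := ltngtP i j.
    by case: (xi _ _ ij (ltn_ord j)).
  by case: (xi _ _ ji (ltn_ord i)).
move=> i /=; have [im|im] := ltnP i.+1 m.
  by rewrite modn_small //; apply: xe.
have im' : i.+1 = m by have := ltn_ord i; lia.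
by have := xe i (ltn_ord i); rewrite im' modnn xm.
Qed.

Hypothesis e_irr : irreflexive e.

(** Pass to a shortest repetition between [i] and [j]: gap 1 would be a loop and gap 2 a
    backtracking step, so it is a genuine cycle. *)
Lemma closed_nb_walk_cycle x l i j : nb_walk e x l -> i < j -> j <= l ->
  x i = x j -> exists m, 3 <= m <= j - i /\ has_cycle e m.
Proof.
move=> [xe xn]; have [n] := ubnP (j - i); elim: n i j => // n IH i j dn ij jl xij.
case: (pselect (exists i' j', [/\ i <= i', i' < j', j' <= j, j' - i' < j - i & x i' = x j'])).
  move=> [i' [j' [ii' ij' jj' dd xij']]].
  have [||||m [mb mc]] := IH i' j'; rewrite //; try lia.
  by exists m; split=> //; lia.
move=> ninj.
have ge3 : 3 <= j - i.
  case dE: (j - i) => [|[|[|d]]]; rewrite //; first by lia.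
    have := xe i; rewrite xij; have -> : i.+1 = j by lia.
    by rewrite e_irr => /(_ ltac:(lia)).
  have := xn i; rewrite xij; have -> : i.+2 = j by lia.
  by rewrite eqxx => /(_ ltac:(lia)).
exists (j - i); split; first by rewrite ge3 leqnn.
apply: (@cycle_of_injective (fun s => x (i + s))).
- by lia.
- by move=> s sl; rewrite addnS; apply: xe; lia.
- by rewrite addn0 subnKC ?xij // ltnW.
move=> s t st tl xst; apply: ninj; exists (i + s), (i + t); split=> //; lia.
Qed.

(* If a vertex repeats, the closed walk splits into two closed walks, the
   shorter of which has length at most half of [l.*2]. *)
Lemma nb_closed_forbidden x k l : 0 < l <= k -> nb_closed e x l.*2 ->
  exists m, forbidden k m /\ has_cycle e m.
Proof.
move=> lk [xp xe xn].
have nbw s : nb_walk e x s by split.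
have short i j : i < j -> j - i <= l -> x i = x j ->
    exists m, forbidden k m /\ has_cycle e m.
  move=> ij jl xij; have [m [mb mc]] := closed_nb_walk_cycle (nbw j) ij (leqnn j) xij.
  by exists m; split=> //; rewrite /forbidden; lia.
case: (pselect (exists i j, [/\ i < j, j < l.*2 & x i = x j])).
  move=> [i [j [ij jl xij]]].
  have [d|d] := leqP (j - i) l; first exact: short d _.
  (* The complementary arc, from [j] to [i] one period later, is the short one. *)
  by apply: (short j (i + l.*2)); [lia|lia|rewrite xp].
move=> ninj; exists l.*2; split.
  have l1 : l != 1.
    by apply/eqP=> l1; move: (xn 0); rewrite -[in x 0]xp l1 eqxx.
  rewrite /forbidden; apply/orP; right; rewrite odd_double; lia.
apply: (@cycle_of_injective x); first by lia.
- by move=> i _; apply: xe.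
- by rewrite -[RHS]xp.
by move=> i j ij jl xij; apply: ninj; exists i, j.
Qed.

Lemma nb_closed_of_walk w L : 1 < L ->
  (forall i, i < L -> e (w i) (w i.+1)) -> w L = w 0 ->
  (forall i, i.+1 < L -> w i != w i.+2) -> w L.-1 != w 1 ->
  nb_closed e (fun i => w (i %% L)) L.
Proof.
move=> L1 we wL wn wn1.
have key i : i.+1 %% L = if i %% L == L.-1 then 0 else (i %% L).+1.
  rewrite -addn1 -modnDml addn1; have := ltn_pmod i (ltnW L1).
  case: eqP => [->|ne] lt; first by rewrite prednK ?modnn //; lia.
  by rewrite modn_small; lia.
split=> i.
- by rewrite modnDr.
- rewrite key; have := ltn_pmod i (ltnW L1).
  case: eqP => [->|ne] lt; last by apply: we.
  rewrite -wL; have := we L.-1; have -> : L.-1.+1 = L by lia.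
  by apply; lia.
rewrite !key; have := ltn_pmod i (ltnW L1).
case: (eqVneq (i %% L) L.-1) => [->|ne] lt.
  by have -> : (0 == L.-1) = false by lia.
case: (eqVneq (i %% L).+1 L.-1) => [il|ne2]; last by apply: wn; lia.
rewrite -wL; have -> : w L = w (i %% L).+2 by congr w; lia.
by apply: wn; lia.
Qed.

Hypothesis e_sym : symmetric e.

(** If the walks differ at [s], let [a] and [b] be their nearest agreements before and after [s].
    Following [x] from [a] to [b] and [y] back gives a closed walk of length at most [2k], which
    does not backtrack at its two ends because the walks differ strictly in between. *)
Lemma nb_walk_unique k x y : nb_walk e x k -> nb_walk e y k ->
  x 0 = y 0 -> x k = y k -> (forall m, forbidden k m -> ~ has_cycle e m) ->
  forall i, i <= k -> x i = y i.
Proof.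
move=> [xe xn] [ye yn] xy0 xyk free s sk; apply/eqP; apply: contraT => xys.
have exa : exists i, (i <= s) && (x i == y i) by exists 0; rewrite xy0 eqxx.
have [|a /andP[as_ /eqP xya] amax] := ex_maxnP exa (m := s); first by move=> i /andP[].
have exb : exists i, (s <= i <= k) && (x i == y i) by exists k; rewrite xyk eqxx sk leqnn.
have [b /andP[/andP[sb bk] /eqP xyb] bmin] := ex_minnP exb.
have sa : s != a by apply: contraNneq xys => ->; rewrite xya.
have sb' : s != b by apply: contraNneq xys => ->; rewrite xyb.
have diff i : a < i -> i < b -> x i != y i.
  move=> ai ib; apply/negP => xyi; have [is_|si] := leqP i s.
    by have := amax i; rewrite is_ xyi => /(_ isT); lia.
  have := bmin i; rewrite xyi andbT; lia.
pose L := (b - a).*2.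
pose w i := if i <= b - a then x (a + i) else y (a + (L - i)).
have w1 i : i <= b - a -> w i = x (a + i) by rewrite /w => ->.
have w2 i : b - a <= i -> w i = y (a + (L - i)).
  move=> bi; rewrite /w; case: ifP => // ib; have -> : i = b - a by lia.
  by rewrite (_ : a + (b - a) = b) 1?(_ : a + (L - _) = b) // /L; lia.
have wL : w L = w 0.
  by rewrite w2 ?w1 /L; try lia; rewrite subnn addn0.
have [||m [fm cm]] := @nb_closed_forbidden (fun i => w (i %% L)) k (b - a).
- lia.
- apply: nb_closed_of_walk => //.
  + by rewrite -/L /L; lia.
  + rewrite -/L => i iL; have [ib|ib] := ltnP i (b - a).
      by rewrite !w1 ?addnS; [apply: xe|..]; lia.
    rewrite !w2; try lia; rewrite e_sym (_ : L - i = (L - i.+1).+1); last by lia.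
    by rewrite addnS; apply: ye; rewrite /L in iL *; lia.
  + rewrite -/L => i iL; have [ib|ib] := ltnP i.+1 (b - a).
      by rewrite !w1 ?addnS; [apply: xn|..]; lia.
    have [ib'|ib'] := eqVneq i.+1 (b - a).
      rewrite w1 ?w2; try lia.
      have -> : a + (L - i.+2) = a + i by rewrite /L; lia.
      by apply: diff; lia.
    rewrite !w2; try lia; rewrite eq_sym (_ : L - i = (L - i.+2).+2); last by lia.
    by rewrite !addnS; apply: yn; rewrite /L in iL *; lia.
  rewrite -/L (w2 L.-1) ?(w1 1) /L; try lia; rewrite eq_sym.
  have -> : a + ((b - a).*2 - (b - a).*2.-1) = a + 1 by lia.
  by apply: diff; lia.
by case: (free m fm).
Qed.

End NonBacktracking.

(** * Counting non-backtracking walks *)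

Section Counting.

Variables (T : finType) (e : rel T) (S : {set T}).
Hypothesis (e_sym : symmetric e).

Definition nbhd (v : T) : {set T} := [set w in S | e v w]%SET.

(* Number of non-backtracking walks with j + 1 edges whose first edge is u v,
   all of whose vertices after u and v lie in S, and which end at z. *)
Fixpoint nbw_to (j : nat) (u v z : T) : nat :=
  if j is j'.+1 then \sum_(w in nbhd v | w != u) nbw_to j' v w z else (v == z).

Fixpoint nbw (j : nat) (u v : T) : nat :=
  if j is j'.+1 then \sum_(w in nbhd v | w != u) nbw j' v w else 1.

Lemma nbwE j u v : v \in S -> nbw j u v = \sum_(z in S) nbw_to j u v z.
Proof.
elim: j u v => [|j IH] u v vS /=.
  rewrite (bigD1 v) //= eqxx big1 ?addn0 // => z /andP[_ /negPf].
  by rewrite eq_sym => ->.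
rewrite exchange_big /=; apply: eq_bigr => w /andP[].
by rewrite inE => /andP[wS _] _; apply: IH.
Qed.

Definition cons_walk (u : T) (x : nat -> T) : nat -> T :=
  fun i => if i is i'.+1 then x i' else u.

Lemma nb_walk_cons u x l : nb_walk e x l -> e u (x 0) -> (0 < l -> u != x 1) ->
  nb_walk e (cons_walk u x) l.+1.
Proof.
by move=> [xe xn] eu nu; split=> [[|i]|[|i]] //= il; [apply: xe|apply: xn].
Qed.

Lemma nbw_to_gt0 j u v z : e u v -> 0 < nbw_to j u v z ->
  exists x, [/\ nb_walk e x j.+1, x 0 = u, x 1 = v & x j.+1 = z].
Proof.
elim: j u v => [|j IH] u v euv /=.
  rewrite lt0b => /eqP <-; exists (cons_walk u (fun=> v)); split=> //.
  by split=> [[|]|].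
rewrite lt0n sum_nat_eq0 negb_forall => /existsP[w]; rewrite negb_imply -lt0n.
move=> /andP[/andP[wv wu] /(IH v w)[|x [xw x0 x1 xz]]].
  by move: wv; rewrite inE => /andP[].
exists (cons_walk u x); split=> //; apply: nb_walk_cons => //; rewrite ?x0 //.
by rewrite x1 eq_sym.
Qed.

Lemma sum_gt1 (I : finType) (P : pred I) (F : I -> nat) :
  1 < \sum_(i | P i) F i ->
  (exists i, P i /\ 1 < F i) \/
  (exists i j, [/\ P i, P j, i != j, 0 < F i & 0 < F j]).
Proof.
move=> S1; have : \sum_(i | P i) F i != 0 by lia.
rewrite sum_nat_eq0 negb_forall => /existsP[i]; rewrite negb_imply -lt0n.
move=> /andP[Pi Fi]; have [Fi1|Fi1] := ltnP 1 (F i); first by left; exists i.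
right; move: S1; rewrite (bigD1 i) //= => S1.
have : \sum_(j | P j && (j != i)) F j != 0 by lia.
rewrite sum_nat_eq0 negb_forall => /existsP[j]; rewrite negb_imply -lt0n.
by move=> /andP[/andP[Pj ji] Fj]; exists i, j; rewrite eq_sym.
Qed.

Lemma nbw_to_gt1 j u v z : e u v -> 1 < nbw_to j u v z ->
  exists x y, [/\ nb_walk e x j.+1 /\ nb_walk e y j.+1, x 0 = u /\ y 0 = u,
    x 1 = v /\ y 1 = v, x j.+1 = z /\ y j.+1 = z & exists2 i, i <= j.+1 & x i <> y i].
Proof.
elim: j u v => [|j IH] u v euv /=; first by case: eqP.
have step w x : w \in nbhd v -> w != u -> nb_walk e x j.+1 -> x 0 = v -> x 1 = w ->
    nb_walk e (cons_walk u x) j.+2.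
  move=> wv wu xw x0 x1; apply: nb_walk_cons => //; first by rewrite x0.
  by rewrite x1 eq_sym.
have evw w : w \in nbhd v -> e v w by rewrite inE => /andP[].
move=> /sum_gt1[[w [/andP[wv wu] /(IH v w (evw _ wv))]]|].
  move=> [x [y [[xw yw] [x0 y0] [x1 y1] [xz yz] [i ij xyi]]]].
  exists (cons_walk u x), (cons_walk u y); split=> //; first by split; apply: (step w).
  by exists i.+1.
move=> [w [w' [/andP[wv wu] /andP[wv' wu'] ww' /(nbw_to_gt0 (evw _ wv)) X /(nbw_to_gt0 (evw _ wv')) Y]]].
case: X => x [xw x0 x1 xz]; case: Y => y [yw y0 y1 yz].
exists (cons_walk u x), (cons_walk u y); split=> //.
- by split; [apply: (step w)|apply: (step w')].
by exists 2 => //=; rewrite x1 y1; apply/eqP.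
Qed.

Lemma sum_nbw_to_le1 j u z :
  (forall x y, nb_walk e x j.+1 -> nb_walk e y j.+1 -> x 0 = y 0 ->
     x j.+1 = y j.+1 -> forall i, i <= j.+1 -> x i = y i) ->
  \sum_(v in nbhd u) nbw_to j u v z <= 1.
Proof.
move=> uniq; rewrite leqNgt; apply/negP => /sum_gt1.
have evw w : w \in nbhd u -> e u w by rewrite inE => /andP[].
case=> [[v [vu /(nbw_to_gt1 (evw _ vu))]]|[v [w [vu wu vw]]]].
  move=> [x [y [[xw yw] [x0 y0] [x1 y1] [xz yz] [i ij]]]]; apply.
  by apply: uniq; rewrite ?x0 ?xz.
move=> /(nbw_to_gt0 (evw _ vu))[x [xw x0 x1 xz]].
move=> /(nbw_to_gt0 (evw _ wu))[y [yw y0 y1 yz]].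
by case/eqP: vw; rewrite -x1 -y1; apply: uniq; rewrite ?x0 ?xz.
Qed.

(** Sort the walks by their ends: there are [#|S| ^ 2] pairs of ends, and each carries at most one
    walk. *)
Lemma sum_nbw_le j :
  (forall x y, nb_walk e x j.+1 -> nb_walk e y j.+1 -> x 0 = y 0 ->
     x j.+1 = y j.+1 -> forall i, i <= j.+1 -> x i = y i) ->
  \sum_(u in S) \sum_(v in nbhd u) nbw j u v <= #|S| ^ 2.
Proof.
move=> uniq; rewrite -mulnn -sum_nat_const leq_sum // => u uS.
rewrite (eq_bigr (fun v => \sum_(z in S) nbw_to j u v z)); last first.
  by move=> v; rewrite inE => /andP[vS _]; apply: nbwE.
rewrite exchange_big /= -sum1_card leq_sum // => z zS.
exact: sum_nbw_to_le1.
Qed.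

End Counting.

(** * Graphs, arcs and the Turan number *)

Definition arcs (T : finType) (e : rel T) (S : {set T}) : nat :=
  \sum_(u in S) #|nbhd e S u|.

Lemma arcs_setT (T : finType) (e : rel T) :
  arcs e [set: T]%SET = #|[set p : T * T | e p.1 p.2]%SET|.
Proof.
transitivity (\sum_(u : T) \sum_(v | e u v) 1).
  apply: eq_big => u; rewrite ?inE // => _; rewrite -sum1_card.
  by apply: eq_bigl => v; rewrite !inE.
by rewrite pair_big_dep -sum1_card; apply: eq_bigl => p; rewrite inE.
Qed.

Section Edges.

Variable (n : nat).
Implicit Type G : sgraph n.

Definition adj G : rel 'I_n := fun u v => [set u; v]%SET \in edges G.

Lemma card_edge G E : E \in edges G -> #|E| = 2.
Proof. by case: G => X hX /= EX; apply/eqP; apply: (forall_inP hX). Qed.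

Lemma adj_sym G : symmetric (adj G).
Proof. by move=> u v; rewrite /adj finset.setUC. Qed.

Lemma adj_irr G : irreflexive (adj G).
Proof.
by move=> u; apply/negP => /card_edge; rewrite finset.setUid cards1.
Qed.

Lemma arcs_edges G : arcs (adj G) [set: 'I_n]%SET = 2 * #|edges G|.
Proof.
rewrite arcs_setT -sum1_card (eq_bigl (fun p => adj G p.1 p.2)); last by move=> p; rewrite inE.
rewrite (partition_big (fun p => [set p.1; p.2]%SET) (fun E => E \in edges G)) //=.
rewrite mulnC -sum_nat_const; apply: eq_bigr => E EG; rewrite sum1_card.
have /eqP/cards2P[x [y [xy EE]]] := card_edge EG.
transitivity #|[set (x, y); (y, x)]%SET|; last first.
  by rewrite cards2 xpair_eqE negb_and xy.
apply: eq_card => -[u v]; rewrite !inE /= unfold_in /= !xpair_eqE /adj.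
apply/andP/orP => [[_ /eqP uvE]|].
  have uE : u \in [set x; y]%SET by rewrite -EE -uvE !inE eqxx.
  have vE : v \in [set x; y]%SET by rewrite -EE -uvE !inE eqxx orbT.
  have uv : u != v.
    by apply: contraTneq EG => uv; rewrite -uvE uv -/(adj G v v) adj_irr.
  move: uE vE uv; rewrite !inE => /orP[]/eqP-> /orP[]/eqP->; rewrite !eqxx //=; by [left|right].
by case=> /andP[/eqP-> /eqP->]; rewrite -?EE ?EG //; split=> //; rewrite ?(finset.setUC [set y]) -?EE.
Qed.

Lemma contains_cycle G m : 3 <= m ->
  contains G (cycle_graph m) <-> has_cycle (adj G) m.
Proof.
move=> m3; split=> [] [f [fi fe]]; exists f; split=> //.
  move=> i; rewrite /adj; apply: (fintype.subsetP fe).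
  apply/imsetP; exists [set i; ordS i]%SET; last by rewrite imsetU !imset_set1.
  rewrite inE cards2 (_ : i != ordS i); first by apply/existsP; exists i.
  apply/eqP => /(congr1 val) /=; have := ltn_ord i; rewrite leq_eqVlt.
  case/orP => [/eqP im|im]; last by rewrite modn_small //; lia.
  by rewrite im modnn; lia.
apply/fintype.subsetP => E /imsetP[E']; rewrite inE => /andP[_ /existsP[i /eqP->]] ->.
by rewrite imsetU !imset_set1; apply: fe.
Qed.

Lemma family_freeP (k : nat) G :
  family_free (even_cycles k `|` short_cycles k)%classic G <->
  forall m, forbidden k m -> ~ has_cycle (adj G) m.
Proof.
split=> [free m fm|free H].
  have m3 : 3 <= m by rewrite /forbidden in fm; lia.
  move=> /(contains_cycle G m3); apply: (free (cycle_member m)).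
  move: fm => /orP[m3k|/and3P[m4 mk ev]]; [right; exists m|left; exists m./2] => //=.
    by lia.
  by congr cycle_member; lia.
case=> [[i /= /andP[i2 ik] <-]|[i /= /andP[i3 ik] <-]] /=.
  move=> /contains_cycle => /(_ ltac:(lia)); apply: free.
  by rewrite /forbidden; lia.
move=> /contains_cycle => /(_ i3); apply: free.
by rewrite /forbidden; lia.
Qed.

End Edges.

(** * Tree graphs with a relation on the leaves *)

Section TreeGraph.

Variables (F : eqType) (x0 : F) (k : nat) (leaf_adj : rel (seq F)).
Hypothesis k_gt0 : 0 < k.
Hypothesis leaf_size : forall x y, leaf_adj x y -> size x = k /\ size y = k.
Hypothesis leaf_sym : symmetric leaf_adj.
Hypothesis leaf_inj : forall x y y', leaf_adj x y -> leaf_adj x y' ->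
  nth x0 y 0 = nth x0 y' 0 -> y = y'.

Definition parent (s : seq F) : seq F := take (size s).-1 s.

(* The root [::] is its own parent, hence carries a loop. *)
Definition tree_adj : rel (seq F) :=
  fun s t => [|| s == parent t, t == parent s | leaf_adj s t].

Lemma size_parent s : size (parent s) = (size s).-1.
Proof. by rewrite size_takel // leq_pred. Qed.

Lemma tree_adj_inner s t : tree_adj s t -> size s != k ->
  s = parent t \/ t = parent s.
Proof.
move=> /or3P[/eqP|/eqP|/leaf_size[-> _]]; rewrite ?eqxx //; by [left|right].
Qed.

(** Labels the neighbours of a leaf: [None] for the parent, the first letter for a leaf, which is
    told apart by it thanks to [leaf_inj]. The labels form a projective line over the alphabet. *)
Definition direction (v : seq F) : option F :=
  if size v == k then Some (nth x0 v 0) else None.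

(* The visits of a non-backtracking walk to two leaves at even times, 2h steps
   apart: either the walk goes through the common ancestor of y and y' at
   height h, or it goes through leaves x and x' adjacent to y and y', whose
   common ancestor is at height h - 1. *)
Definition jump (p : option F) (h : nat) (y y' : seq F) : Prop :=
  [/\ size y = k, size y' = k, y != y' &
    if p is Some a then
      exists x x', [/\ leaf_adj x y /\ leaf_adj x' y',
        nth x0 x 0 = a, nth x0 x' 0 = a
      & take (k - h.-1) x = take (k - h.-1) x']
    else take (k - h) y = take (k - h) y'].

Fixpoint chain (y : seq F) (s : seq (option F * nat * seq F)) (z : seq F) : Prop :=
  if s is (p, h, y') :: s' then [/\ 0 < h, jump p h y y' & chain y' s' z] else y = z.

(** * Cutting a non-backtracking walk at its visits to leaves *)

Section Walks.

Variable (x : nat -> seq F).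
Hypothesis x_size : forall i, size (x i) <= k.
Hypothesis x_adj : forall i, tree_adj (x i) (x i.+1).
Hypothesis x_nb : forall i, x i != x i.+2.

Lemma leaf_next i : size (x i) = k ->
  x i.+1 = parent (x i) \/ leaf_adj (x i) (x i.+1).
Proof.
move=> xk; case/or3P: (x_adj i) => [/eqP xP|/eqP ->|]; [|by left|by right].
by have := size_parent (x i.+1); rewrite -xP xk; have := x_size i.+1; lia.
Qed.

Lemma leaf_prev i : size (x i.+1) = k ->
  x i = parent (x i.+1) \/ leaf_adj (x i.+1) (x i).
Proof.
move=> xk; case/or3P: (x_adj i) => [/eqP ->|/eqP xP|]; [by left| |by rewrite leaf_sym; right].
by have := size_parent (x i); rewrite -xP xk; have := x_size i; lia.
Qed.

(** The vertices before and after a leaf are distinct neighbours of it, and neighbours of a leaf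
    differ in direction. *)
Lemma direction_neq i : size (x i.+1) = k -> direction (x i) != direction (x i.+2).
Proof.
move=> xk; apply: contra_neq (x_nb i); rewrite /direction.
have pk : size (parent (x i.+1)) == k = false by rewrite size_parent xk; lia.
case: (leaf_prev xk) => [->|l1]; case: (leaf_next xk) => [->|l2]; rewrite ?pk //.
- by rewrite (leaf_size l2).2 eqxx.
- by rewrite (leaf_size l1).2 eqxx.
by rewrite (leaf_size l1).2 (leaf_size l2).2 eqxx => -[]; apply: leaf_inj l1 l2.
Qed.

(** After a step down the only way up is the one just taken, so the walk keeps descending until
    level [k], each vertex being a prefix of the later ones. *)
Lemma descend s j : x s = parent (x s.+1) -> x s.+1 != [::] -> size (x s) + j <= k ->
  size (x (s + j)) = size (x s) + j /\
  (forall i, i <= j -> take (size (x s) + i) (x (s + j)) = x (s + i)) /\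
  (0 < j -> x (s + j).-1 = parent (x (s + j))).
Proof.
move=> xs xs1; elim: j => [|j IH] jk.
  by rewrite !addn0; split=> //; split=> // i; rewrite leqn0 => /eqP->; rewrite !addn0 take_size.
have [|IH1 [IH2 IH3]] := IH; first by lia.
suff xP : x (s + j) = parent (x (s + j.+1)) /\ x (s + j.+1) != [::].
  have sE : size (x (s + j.+1)) = size (x s) + j.+1.
    have := size_parent (x (s + j.+1)); rewrite -xP.1 IH1.
    by move: xP.2; rewrite -size_eq0; lia.
  split=> //; split=> [i|_]; last by rewrite -xP.1 addnS.
  rewrite leq_eqVlt => /orP[/eqP->|ij]; first by rewrite -sE take_size.
  by rewrite -(IH2 i) // xP.1 /parent take_takel // sE; lia.
case: j IH2 IH3 IH1 jk {IH} => [|j] IH2 IH3 IH1 jk; first by rewrite addn0 addn1.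
have {}IH3 : x (s + j) = parent (x (s + j.+1)) by rewrite -(IH3 isT) addnS.
have nk : size (x (s + j.+1)) != k by lia.
have [||xP] := tree_adj_inner (x_adj (s + j.+1)); rewrite -?addnS //.
  move=> xP; split=> //; apply/eqP => nil1.
  by move: IH1; rewrite xP nil1 /=; lia.
by have := x_nb (s + j); rewrite IH3 -xP !addnS eqxx.
Qed.

(** A walk that leaves a leaf upwards climbs [u] steps, turns, and descends [u] steps to another
    leaf. The second alternative is the detour through the loop at the root, which takes more than
    [2k] steps to reach a leaf. *)
Lemma excursion s : size (x s) = k -> size (x s.+1) != k ->
  (exists u, [/\ 0 < u <= k, forall j, 0 < j < u.*2 -> size (x (s + j)) != k,
     size (x (s + u.*2)) = k, x (s + u.*2).-1 = parent (x (s + u.*2))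
   & take (k - u) (x s) = take (k - u) (x (s + u.*2)) /\ x s != x (s + u.*2)]) \/
  (forall j, 0 < j <= k.*2 -> size (x (s + j)) != k).
Proof.
move=> sk s1.
set goal := (X in X \/ _).
have turn m : 0 < m <= k -> (forall u, u <= m -> x (s + u) = take (k - u) (x s)) ->
    x (s + m) = parent (x (s + m).+1) -> x (s + m).+1 != [::] -> goal.
  move=> mk climb xm nil1; have sm : size (x (s + m)) = k - m by rewrite climb // size_takel ?sk; lia.
  exists m; have D j := @descend (s + m) j xm nil1.
  have [|D1 [D2 D3]] := D m; first by lia.
  rewrite -addnn addnA; split=> //.
  - move=> j jm; have [jm'|jm'] := leqP j m; first by rewrite climb // size_takel ?sk; lia.
    have [|] := D (j - m); first by lia.
    by rewrite (_ : s + m + (j - m) = s + j) => [-> _|]; lia.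
  - lia.
  - by apply: D3; lia.
  split; first by have := D2 0 isT; rewrite !addn0 sm => ->; rewrite climb.
  apply: contra_neq (x_nb (s + m).-1) => xsm; rewrite prednK; last by lia.
  have -> : (s + m).-1 = s + m.-1 by lia.
  have := D2 1; rewrite [s + m + 1]addn1 sm => <-; last by lia.
  by rewrite climb -?xsm; [congr take|]; lia.
have climb m : m <= k -> goal \/ forall u, u <= m -> x (s + u) = take (k - u) (x s).
  elim: m => [|m IH] mk.
    by right=> u; rewrite leqn0 => /eqP->; rewrite addn0 subn0 -sk take_size.
  case: (IH (ltnW mk)) => [gl|cl]; first by left.
  have sm : size (x (s + m)) = k - m by rewrite cl // size_takel ?sk; lia.
  suff [gl|xm] : goal \/ x (s + m).+1 = parent (x (s + m)).
  - by left.
  - right=> u; rewrite leq_eqVlt => /orP[/eqP->|]; last exact: cl.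
    by rewrite addnS xm /parent sm cl // take_takel //; [congr take|]; lia.
  have [m0|m0] := posnP m.
    rewrite m0 addn0; case: (leaf_next sk); first by right.
    by move=> /leaf_size[_ /eqP]; rewrite (negbTE s1).
  case: (tree_adj_inner (x_adj (s + m))); [by lia| |by right].
  move=> xm; left; apply: (turn m _ cl xm); first by lia.
  by apply/eqP => nil1; move: sm; rewrite xm nil1 /=; lia.
case: (climb k (leqnn k)) => [gl|cl]; first by left.
have xk : x (s + k) = [::] by rewrite cl // subnn take0.
have [nil1|nil1] := eqVneq (x (s + k).+1) [::]; last first.
  left; apply: (turn k _ cl _ nil1); first by lia.
  case: (tree_adj_inner (x_adj (s + k))) => //; first by rewrite xk /=; lia.
  by rewrite xk => nil1'; rewrite nil1' in nil1.
right=> j jk.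
have nil2 : x (s + k).+2 != [::] by rewrite -xk eq_sym x_nb.
have xp : x (s + k).+1 = parent (x (s + k).+2).
  case: (tree_adj_inner (x_adj (s + k).+1)) => //; first by rewrite nil1 /=; lia.
  by rewrite nil1 => nil2'; rewrite nil2' in nil2.
have [jk'|jk'] := leqP j k; first by rewrite cl // size_takel ?sk; lia.
have [|] := @descend (s + k).+1 (j - k.+1) xp nil2; first by rewrite nil1 /=; lia.
have -> : (s + k).+1 + (j - k.+1) = s + j by lia.
by rewrite nil1 /= => -> _; lia.
Qed.

(** If the first step goes up, the excursion has height [h]. If it goes to a leaf, the walk either
    steps to a leaf once more ([h = 1]) or makes an excursion of height [h - 1] followed by a step
    between leaves. *)
Lemma jump_of_walk i h : 0 < h <= k -> size (x i) = k -> size (x (i + h.*2)) = k ->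
  (forall j, 0 < j < h -> size (x (i + j.*2)) != k) ->
  jump (direction (x i.+1)) h (x i) (x (i + h.*2)) /\
  direction (x (i + h.*2).-1) = direction (x i.+1).
Proof.
move=> hk ik hxk hmin; have [i1k|i1k] := eqVneq (size (x i.+1)) k; last first.
  have [[u [uk unk xuk xup [tk xuu]]]|nk] := excursion ik i1k; last first.
    by have := nk h.*2; rewrite hxk eqxx => /(_ ltac:(lia)).
  have uh : u = h.
    have [uh|uh|//] := ltngtP u h; first by have := hmin u; rewrite xuk eqxx => /(_ ltac:(lia)).
    by have := unk h.*2; rewrite hxk eqxx => /(_ ltac:(lia)).
  rewrite -uh in hxk *; rewrite /direction (negbTE i1k) xup size_parent xuk.
  by rewrite (_ : (k.-1 == k) = false); [|lia].
have dirE j : size (x j) = k -> direction (x j) = Some (nth x0 (x j) 0).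
  by move=> xjk; rewrite /direction xjk eqxx.
have leafR j : size (x j) = k -> size (x j.+1) = k -> leaf_adj (x j) (x j.+1).
  move=> jk j1k; case: (leaf_next jk) => // xP.
  by have := size_parent (x j); rewrite -xP jk j1k; lia.
have [h1|h1] := eqVneq h 1.
  rewrite h1 !addnS addn0 /= in hxk *; split=> //; split=> //.
  rewrite dirE //; exists (x i.+1), (x i.+1); split=> //; split.
    by rewrite leaf_sym; apply: leafR.
  exact: leafR.
have i2k : size (x i.+2) != k.
  by have := hmin 1; rewrite !addnS addn0; apply; lia.
have [[u [uk unk xuk xup [tk xuu]]]|nk] := excursion i1k i2k; last first.
  by have := nk h.*2.-1; rewrite (_ : i.+1 + _ = i + h.*2) ?hxk ?eqxx; [move=> /(_ ltac:(lia))|lia].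
(* The excursion ends with a step down, and going back up would backtrack, so the walk moves on to
   an adjacent leaf. *)
have u2k : size (x (i.+1 + u.*2).+1) = k.
  case: (leaf_next xuk) => [xP|/leaf_size[]//].
  by have := x_nb (i.+1 + u.*2).-1; rewrite prednK ?xP ?xup ?eqxx //; lia.
have uE : (i.+1 + u.*2).+1 = i + u.+1.*2 by lia.
have uh : h = u.+1.
  have [uh|uh|//] := ltngtP h u.+1.
    have := unk h.*2.-1; rewrite (_ : i.+1 + _ = i + h.*2) ?hxk ?eqxx; last by lia.
    by move=> /(_ ltac:(lia)).
  by have := hmin u.+1; rewrite -uE u2k eqxx => /(_ ltac:(lia)).
have hE : (i + h.*2).-1 = i.+1 + u.*2 by lia.
(* Since [u < k], the common prefix contains the first letter. *)
have nthE : nth x0 (x i.+1) 0 = nth x0 (x (i.+1 + u.*2)) 0.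
  by rewrite -(@nth_take (k - u)) ?tk ?nth_take //; lia.
have adj1 : leaf_adj (x i.+1) (x i) by rewrite leaf_sym leafR.
have adj2 : leaf_adj (x (i.+1 + u.*2)) (x (i + h.*2)).
  by rewrite uh -uE; apply: leafR.
rewrite hE !dirE // -nthE; split=> //; split=> //.
  apply: contra_neq xuu => xih; apply: leaf_inj nthE; first by rewrite leaf_sym; exact: adj1.
  by rewrite xih leaf_sym.
by exists (x i.+1), (x (i.+1 + u.*2)); split=> //; rewrite uh.
Qed.

(** Induction on [l], splitting off the jump to the first leaf visited at a positive even time;
    [direction_neq] at that leaf separates consecutive directions. *)
Lemma chain_of_walk l i : 0 < l <= k -> size (x i) = k -> size (x (i + l.*2)) = k ->
  exists p h y s, [/\ chain (x i) ((p, h, y) :: s) (x (i + l.*2)),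
    h + sumn [seq t.1.2 | t <- s] = l,
    p = direction (x i.+1), last p [seq t.1.1 | t <- s] = direction (x (i + l.*2).-1)
    & path (fun p q => p != q) p [seq t.1.1 | t <- s]].
Proof.
have [n] := ubnP l; elim: n l i => // n IH l i ln lk ik ilk.
have exh : exists h, (0 < h) && (size (x (i + h.*2)) == k).
  by exists l; rewrite ilk eqxx andbT; case/andP: lk.
have [h /andP[h0 /eqP hxk] hmin] := ex_minnP exh.
have hl : h <= l by apply: hmin; rewrite ilk eqxx andbT; case/andP: lk.
have [||||J Jd] := @jump_of_walk i h; rewrite ?ik //; first by lia.
  move=> j /andP[j0 jh]; apply/negP => jk; have := hmin j; rewrite j0 jk; lia.
have [hlE|hl'] := eqVneq h l.
  by exists (direction (x i.+1)), h, (x (i + h.*2)), [::]; rewrite -hlE /= addn0 Jd; split.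
have lE : i + h.*2 + (l - h).*2 = i + l.*2 by lia.
have [||||p [h' [y [s [C S pE lastE pth]]]]] := IH (l - h) (i + h.*2); rewrite ?lE //; try lia.
rewrite lE in C lastE.
exists (direction (x i.+1)), h, (x (i + h.*2)), ((p, h', y) :: s).
split=> //; first by rewrite /= S; lia.
rewrite /= pth andbT pE -Jd.
have := @direction_neq (i + h.*2).-1; rewrite prednK; last by lia.
exact.
Qed.

(** A walk that ever steps down reaches level [k]. Otherwise it climbs to the root and stays there,
    which is backtracking. *)
Lemma exists_leaf : exists i, size (x i) = k.
Proof.
case: (pselect (exists s, x s = parent (x s.+1) /\ x s.+1 != [::])).
  move=> [s [xs xs1]]; exists (s + (k - size (x s))).
  have [|-> _] := @descend s (k - size (x s)) xs xs1; have := x_size s; lia.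
move=> ndesc; case: (pselect (exists i, size (x i) = k)) => // nleaf; exfalso.
have up s : x s.+1 = parent (x s).
  case: (tree_adj_inner (x_adj s)) => //.
    by apply/eqP => xk; apply: nleaf; exists s.
  move=> xs; have [xs1|xs1] := eqVneq (x s.+1) [::]; last by case: ndesc; exists s.
  by rewrite xs xs1.
have sz s : size (x s) <= k - s.
  elim: s => [|s IH]; first by rewrite subn0.
  by rewrite up size_parent; lia.
have nil s : k <= s -> x s = [::].
  by move=> ks; apply/nilP; rewrite /nilp; have := sz s; lia.
by have := x_nb k; rewrite !nil //; lia.
Qed.

End Walks.

(** The general position to be checked in coordinates. As [cycle] also compares the last direction
    with the first, a single jump is excluded at once. *)
Definition chain_free : Prop := forall y s, chain y s y ->
  0 < sumn [seq t.1.2 | t <- s] <= k ->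
  ~~ cycle (fun p q : option F => p != q) [seq t.1.1 | t <- s].

(** Cut at a leaf, the closed walk becomes a chain of total height [l]; by periodicity the
    directions also differ at the starting leaf. *)
Lemma tree_adj_no_nb_closed x l : chain_free -> 0 < l <= k ->
  (forall i, size (x i) <= k) -> ~ nb_closed tree_adj x l.*2.
Proof.
move=> cf lk xs [xper xadj xnb].
have [i ik] := exists_leaf xs xadj xnb.
have [|||p [h [y [s [C S pE lastE pth]]]]] := @chain_of_walk x xs xadj xnb l i; rewrite ?xper //.
rewrite xper in C; have := cf _ _ C; rewrite [sumn _]/= S => /(_ lk) /negP; apply.
rewrite /= rcons_path pth lastE pE.
have := @direction_neq x xs xadj xnb (i + l.*2).-1.
have i2 : 0 < i + l.*2 by lia.
rewrite prednK // xper => /(_ ik).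
by rewrite -addSn xper.
Qed.

End TreeGraph.

Lemma sgraph_of_rel (T : finType) (e : rel T) : symmetric e -> irreflexive e ->
  exists G : sgraph #|T|, 2 * #|edges G| = #|[set p : T * T | e p.1 p.2]%SET| /\
    forall m, has_cycle (adj G) m -> has_cycle e m.
Proof.
move=> e_sym e_irr.
pose E := [set [set p.1; p.2]%SET | p in [set p : 'I_#|T| * 'I_#|T| |
  e (enum_val p.1) (enum_val p.2)]%SET]%SET.
have EP : [forall A in E, #|A| == 2].
  apply/forall_inP => A /imsetP[[i j]]; rewrite inE /= => eij ->.
  rewrite cards2; suff -> : i != j by [].
  by apply: contraTneq eij => ->; rewrite e_irr.
pose G : sgraph #|T| := exist _ E EP.
have adjE i j : adj G i j = e (enum_val i) (enum_val j).
  apply/imsetP/idP => [[[i' j']]|eij]; last by exists (i, j); rewrite ?inE.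
  rewrite inE /= => eij' ijE.
  have ne : i' != j' by apply: contraTneq eij' => ->; rewrite e_irr.
  have : i' \in [set i; j]%SET by rewrite ijE !inE eqxx.
  have : j' \in [set i; j]%SET by rewrite ijE !inE eqxx orbT.
  by rewrite !inE => /orP[]/eqP j'E /orP[]/eqP i'E;
    rewrite i'E j'E ?eqxx // in ne eij' *; rewrite // e_sym.
exists G; split.
  rewrite -arcs_edges arcs_setT -!sum1_card [RHS](eq_bigl (fun p => e p.1 p.2)); last first.
    by move=> p; rewrite inE.
  rewrite [RHS](reindex (fun p : 'I_#|T| * 'I_#|T| => (enum_val p.1, enum_val p.2))) /=.
    by apply: eq_bigl => p; rewrite inE adjE.
  exists (fun p : T * T => (enum_rank p.1, enum_rank p.2)) => -[u v] _ /=.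
    by rewrite !enum_valK.
  by rewrite !enum_rankK.
move=> m [f [fi fe]]; exists (fun i => enum_val (f i)); split.
  by move=> i j /enum_val_inj/fi.
by move=> i; rewrite -adjE.
Qed.

(** Cycles of length at most [k] are traversed twice, the other even cycles once; both yield a
    closed walk of even length at most [2k]. *)
Lemma nb_closed_of_cycle (T U : eqType) (e : rel T) (e' : rel U) (v : T -> U) k m :
  injective v -> (forall x y, e x y -> e' (v x) (v y)) ->
  forbidden k m -> has_cycle e m ->
  exists (x : nat -> T) l, 0 < l <= k /\ nb_closed e' (v \o x) l.*2.
Proof.
move=> vi ve fm [f [fi fe]]; have m3 : 2 < m by rewrite /forbidden in fm; lia.
have m0 : 0 < m by lia.
pose x i := f (Ordinal (ltn_pmod i m0)).
have xm i : x (i + m) = x i by congr f; apply: val_inj; rewrite /= modnDr.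
have xe i : e (x i) (x i.+1).
  have := fe (Ordinal (ltn_pmod i m0)); congr e; congr f; apply: val_inj => /=.
  by rewrite -addn1 modnDml addn1.
have xn i : x i != x i.+2.
  apply/eqP => /fi /(congr1 val) /= /eqP; rewrite -{1}[i]addn0 -addn2 eqn_modDl.
  by rewrite mod0n modn_small.
have nb l : (forall i, x (i + l.*2) = x i) -> nb_closed e' (v \o x) l.*2.
  move=> xl; split=> i; rewrite /= ?xl ?ve //.
  by apply: contra_neq (xn i) => /vi.
case/orP: fm => [mk|/and3P[m4 mk ev]].
  exists x, m; split; first by lia.
  by apply: nb => i; rewrite -addnn addnA !xm.
exists x, m./2; split; first by lia.
by apply: nb => i; rewrite even_halfK ?xm.
Qed.

(** * The number of edges of the tree graph *)

Section TreeGraphCount.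

Variables (F : finType) (x0 : F) (k : nat) (leaf_adj : rel (seq F)).
Hypothesis k2 : 1 < k.
Hypothesis leaf_size : forall x y, leaf_adj x y -> size x = k /\ size y = k.
Hypothesis leaf_sym : symmetric leaf_adj.
Hypothesis leaf_inj : forall x y y', leaf_adj x y -> leaf_adj x y' ->
  nth x0 y 0 = nth x0 y' 0 -> y = y'.
Hypothesis leaf_nbr : forall x c, size x = k -> exists2 y, leaf_adj x y & nth x0 y 0 = c.
Hypothesis leaf_loop : forall x y, leaf_adj x x -> leaf_adj y y ->
  take k.-1 x = take k.-1 y -> x = y.
Hypothesis no_chain : chain_free x0 k leaf_adj.

Let V : finType := k.-bseq F.

(** Removes the loops, which sit at the root and at leaves related to themselves (absolute points of
    the polarity). *)
Definition gadj : rel V := fun u v => (u != v) && tree_adj leaf_adj u v.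

Lemma gadj_sym : symmetric gadj.
Proof.
by move=> u v; rewrite /gadj eq_sym /tree_adj leaf_sym orbCA.
Qed.

Lemma gadj_irr : irreflexive gadj.
Proof. by move=> u; rewrite /gadj eqxx. Qed.

Lemma gadj_free m : forbidden k m -> ~ has_cycle gadj m.
Proof.
move=> fm cm; have [|x [l [lk nb]]] := nb_closed_of_cycle (v := val) (e' := tree_adj leaf_adj) val_inj _ fm cm.
  by move=> u v /andP[].
apply: (tree_adj_no_nb_closed (ltnW k2) leaf_size leaf_sym leaf_inj no_chain lk _ nb) => i /=.
exact: size_bseq.
Qed.

Lemma card_leaf_arcs : #|F| ^ k.+1 <= #|[set p : V * V | leaf_adj p.1 p.2]%SET|.
Proof.
have nbr (tc : k.-tuple F * F) : {v : V | leaf_adj tc.1 v /\ nth x0 v 0 = tc.2}.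
  apply/cid; have [y xy yc] := leaf_nbr tc.2 (size_tuple tc.1).
  have yk : size y <= k by rewrite (leaf_size xy).2.
  by exists (Bseq yk).
pose g tc : V * V := (bseq_of_tuple tc.1, sval (nbr tc)).
have gi : injective g.
  move=> [t c] [t' c'] gE; have /= tt' := congr1 (fun p : V * V => bseqval p.1) gE.
  have {gE} /= vv' := congr1 snd gE.
  have [_ nc] := svalP (nbr (t, c)); have [_ nc'] := svalP (nbr (t', c')).
  by rewrite -[c]/(t, c).2 -nc vv' nc' (val_inj tt').
have -> : #|F| ^ k.+1 = #|[set: k.-tuple F * F]%SET|.
  by rewrite cardsT card_prod card_tuple expnSr.
rewrite -(card_imset _ gi); apply: subset_leq_card; apply/fintype.subsetP => p /imsetP[tc _ ->].
by rewrite inE /=; case: (svalP (nbr tc)).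
Qed.

Lemma card_loops : #|[set v : V | leaf_adj v v]%SET| <= #|F| ^ k.-1.
Proof.
rewrite -card_tuple -(card_in_imset (f := fun v : V => [tuple nth x0 v i | i < k.-1])).
  exact: max_card.
move=> u v; rewrite !inE => lu lv uv; apply: val_inj; apply: leaf_loop => //.
have [su _] := leaf_size lu; have [sv _] := leaf_size lv.
apply: (@eq_from_nth _ x0) => [|i]; first by rewrite !size_take su sv.
rewrite size_take su => ik.
have ik' : i < k.-1 by move: ik; case: ifP; lia.
rewrite !nth_take //.
by have := congr1 (fun t => tnth t (Ordinal ik')) uv; rewrite !tnth_mktuple.
Qed.

(** Each vertex but the root gives one arc up and one down, and the leaf relation without its loops
    gives the rest; word lengths keep the three kinds apart. *)
Lemma card_gadj :
  2 * (#|V| - 1) + #|F| ^ k.+1 - #|F| ^ k.-1 <= #|[set p : V * V | gadj p.1 p.2]%SET|.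
Proof.
pose up (p : V * V) := (val p.1 != [::]) && (val p.2 == parent p.1).
pose down (p : V * V) := (val p.2 != [::]) && (val p.1 == parent p.2).
pose leaf (p : V * V) := leaf_adj p.1 p.2 && (p.1 != p.2).
have pk (u : V) : size (parent u) <= k.
  by rewrite size_parent (leq_trans (leq_pred _)) ?size_bseq.
have cup : #|[set p | up p]%SET| = #|V| - 1.
  pose g (u : V) : V * V := (u, Bseq (pk u)).
  have gi : injective g by move=> u v [].
  rewrite subn1 -(cardsC1 ([bseq] : V)) -(card_imset _ gi); apply: eq_card => -[u v].
  rewrite inE /up /=; apply/andP/imsetP => [[u0 /eqP uv]|[w]].
    by exists u; rewrite ?inE //; congr pair; apply: val_inj.
  by rewrite !inE => w0 [-> ->].
have cdown : #|[set p | down p]%SET| = #|V| - 1.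
  pose swap (p : V * V) := (p.2, p.1).
  have si : injective swap by move=> [u v] [u' v'] [-> ->].
  rewrite -cup -[RHS](card_imset _ si); apply: eq_card => -[u v].
  rewrite inE; apply/idP/imsetP => [uv|[[u' v']]]; first by exists (v, u); rewrite ?inE.
  by rewrite inE => h [-> ->].
have cleaf : #|F| ^ k.+1 - #|F| ^ k.-1 <= #|[set p | leaf p]%SET|.
  rewrite leq_subLR; apply: leq_trans card_leaf_arcs _.
  rewrite -(cardsID [set p : V * V | p.1 == p.2]%SET) leq_add //; last first.
    by apply: subset_leq_card; apply/fintype.subsetP => p; rewrite !inE andbC.
  apply: leq_trans card_loops; rewrite -(card_in_imset (f := fst)); last first.
    by move=> [u v] [u' v']; rewrite !inE /= => /andP[_ /eqP<-] /andP[_ /eqP<-] ->.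
  apply: subset_leq_card; apply/fintype.subsetP => u /imsetP[[v w]].
  by rewrite !inE /= => /andP[vw /eqP vwE] ->; rewrite -vwE in vw.
have upS p : up p -> size (val p.1) = (size (val p.2)).+1.
  by move=> /andP[p0 /eqP->]; rewrite size_parent prednK // lt0n size_eq0.
have downS p : down p -> size (val p.2) = (size (val p.1)).+1.
  by move=> /andP[p0 /eqP->]; rewrite size_parent prednK // lt0n size_eq0.
have leafS p : leaf p -> size (val p.1) = size (val p.2).
  by move=> /andP[/leaf_size[-> ->]].
have dis1 : ([set p | up p] :&: [set p | down p] = finset.set0)%SET.
  by apply/setP => p; rewrite !inE; apply/negP => /andP[/upS h /downS]; lia.
have dis2 : (([set p | up p] :|: [set p | down p]) :&: [set p | leaf p] = finset.set0)%SET.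
  by apply/setP => p; rewrite !inE; apply/negP => /andP[/orP[/upS|/downS] h /leafS]; lia.
have sub : ([set p | up p] :|: [set p | down p] :|: [set p | leaf p])%SET \subset
    [set p : V * V | gadj p.1 p.2]%SET.
  apply/fintype.subsetP => p; rewrite !inE /gadj /tree_adj => /orP[/orP[]|] h.
  - have := upS _ h; case/andP: h => _ ->; rewrite orbT andbT => hs.
    by apply/eqP => e; move: hs; rewrite e; lia.
  - have := downS _ h; case/andP: h => _ ->; rewrite andbT => hs.
    by apply/eqP => e; move: hs; rewrite e; lia.
  by case/andP: h => -> ->; rewrite !orbT.
apply: leq_trans (subset_leq_card sub).
have := cardsUI ([set p | up p] :|: [set p | down p])%SET [set p | leaf p]%SET.
have := cardsUI [set p | up p]%SET [set p | down p]%SET.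
rewrite dis1 dis2 !cards0 !addn0 cup cdown => -> ->.
lia.
Qed.

Lemma ex_tree_graph : exists n, [/\ n * #|F|.-1 + 1 = #|F| ^ k.+1 &
  2 * (n - 1) + #|F| ^ k.+1 - #|F| ^ k.-1 <=
    2 * ex n (even_cycles k `|` short_cycles k)%classic].
Proof.
exists #|V|; split.
  by rewrite card_bseq mulnC -predn_exp addn1 prednK // expn_gt0; apply/orP; left; apply/card_gt0P; exists x0.
have [G [GE Gc]] := sgraph_of_rel gadj_sym gadj_irr.
apply: leq_trans card_gadj _; rewrite -GE leq_mul2l /=.
apply: leq_bigmax_cond; apply/asboolP/family_freeP => m fm /Gc.
exact: gadj_free.
Qed.

End TreeGraphCount.

(** * The upper bound *)

Local Open Scope ring_scope.

(** * Logarithmic inequalities *)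

Section Entropy.

Variable (R : realType).

Lemma ln_le_sub1 (x : R) : 0 < x -> ln x <= x - 1.
Proof.
move=> x0; have := @le_ln1Dx R (x - 1); rewrite (_ : 1 + (x - 1) = x); last by ring.
by apply; lra.
Qed.

(** Concavity of [ln]: sum [ln y <= y - 1] over [y = F i / c], where [c] is the mean, so that the
    right-hand sides cancel. *)
Lemma sum_ln_le (I : finType) (P : pred I) (F : I -> R) (c : R) :
  (forall i, P i -> 0 < F i) -> 0 < c ->
  \sum_(i | P i) F i = #|P|%:R * c ->
  \sum_(i | P i) ln (F i) <= #|P|%:R * ln c.
Proof.
move=> F0 c0 Fc.
suff : \sum_(i | P i) (ln (F i) - ln c) <= \sum_(i | P i) (F i / c - 1).
  rewrite !sumrB -!mulr_suml Fc !sumr_const mulfK ?gt_eqF // subrr subr_le0.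
  by rewrite -[ln c *+ _]mulr_natl.
apply: ler_sum => i Pi; rewrite -ln_div ?posrE ?F0 //.
by apply: ln_le_sub1; rewrite divr_gt0 ?F0.
Qed.

Lemma is_derive_xlnx1 (c x : R) : 1 < x ->
  is_derive x 1 (fun y : R => y * ln (y - 1) - y * c)
    (ln (x - 1) + x / (x - 1) - c).
Proof.
move=> x1.
have h1 : is_derive x 1 (fun y : R => y - 1) 1.
  exact: is_derive_shift.
have h2 : is_derive (x - 1) 1 (@ln R) (x - 1)^-1.
  by apply: is_derive1_ln; lra.
have h3 : is_derive x 1 (fun y : R => ln (y - 1)) (x - 1)^-1.
  have := @is_derive1_comp R (@ln R) (fun y : R => y - 1) x _ _ h2 h1.
  by rewrite mulr1.
have h4 := is_deriveM (is_derive_id x (1 : R)) h3.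
have h5 : is_derive x 1 (fun y : R => y * c) c.
  rewrite -[X in is_derive _ _ _ X]mulr1 (_ : (fun y => y * c) = c *: id).
    exact: is_deriveZ.
  by apply/funext => y; rewrite /GRing.scale /= mulrC.
have h6 := is_deriveB h4 h5.
apply: (is_derive_eq h6); rewrite /GRing.scale /=; ring.
Qed.

(* The tangent inequality of the function [x ln (x - 1)], which is convex
   only for [2 <= x]. *)
Lemma xlnx1_tangent (d x : R) : 2 <= d -> 2 <= x ->
  x * ln (d - 1) + d / (d - 1) * (x - d) <= x * ln (x - 1).
Proof.
(* [c] is the slope of [x ln (x - 1)] at [d], so [f] is critical there, and the signs of [df] make
   it a minimum on [[2, +oo[]. *)
move=> d2 x2; pose c := ln (d - 1) + d / (d - 1).
pose f := fun y : R => y * ln (y - 1) - y * c.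
pose df := fun y : R => ln (y - 1) + y / (y - 1) - c.
suff : f d <= f x.
  by rewrite /f /c; lra.
have fder (y : R) : 1 < y -> is_derive y 1 f (df y) by exact: is_derive_xlnx1.
have fc (a b : R) : 1 < a -> {within `[a, b], continuous f}%classic.
  move=> a1; apply: continuous_in_subspaceT => y; rewrite inE /= in_itv /= => /andP[ay _].
  have [fy _] : is_derive y 1 f (df y) by apply: fder; lra.
  by apply/differentiable_continuous/derivable1_diffP.
have dfE y : 2 <= y -> df y = ln ((y - 1) / (d - 1)) + (y - 1)^-1 - (d - 1)^-1.
  move=> y2; rewrite ln_div ?posrE; [|lra|lra]; rewrite /df /c.
  by field; apply/andP; split; lra.
have dfpos y : d <= y -> 0 <= df y.
  move=> dy; rewrite dfE; last lra.
  have q0 : 0 < (y - 1) / (d - 1) by apply: divr_gt0; lra.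
  have := @ln_le_sub1 ((d - 1) / (y - 1)); rewrite -[(d - 1) / _]invf_div.
  rewrite invr_gt0 lnV ?posrE // => /(_ q0) h.
  have : 0 <= (1 - (d - 1) / (y - 1)) * (1 - (d - 1)^-1).
    apply: mulr_ge0; rewrite subr_ge0; first by rewrite ler_pdivrMr; lra.
    by rewrite invf_le1; lra.
  rewrite (_ : _ * _ = 1 - (d - 1) / (y - 1) + (y - 1)^-1 - (d - 1)^-1); first lra.
  by field; apply/andP; split; lra.
have dfneg y : 2 <= y -> y <= d -> df y <= 0.
  move=> y2 yd; rewrite dfE //.
  have := @ln_le_sub1 ((y - 1) / (d - 1)); rewrite (_ : 0 < _); [move=> /(_ isT) h|by apply: divr_gt0; lra].
  have : 0 <= (d - y) / (d - 1) * (1 - (y - 1)^-1).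
    apply: mulr_ge0; first by apply: divr_ge0; lra.
    by rewrite subr_ge0 invf_le1; lra.
  rewrite (_ : _ * _ = 1 - (y - 1) / (d - 1) - (y - 1)^-1 + (d - 1)^-1); first lra.
  by field; apply/andP; split; lra.
have mvt (a b : R) : 2 <= a -> a < b ->
    exists2 y, a < y < b & f b - f a = df y * (b - a).
  move=> a2 ab; have [||y] := @MVT R f df a b ab.
  - by move=> y; rewrite in_itv /= => /andP[ay _]; apply: fder; lra.
  - by apply: fc; lra.
  by rewrite in_itv /=; exists y.
have [dx|xd|->] := ltgtP d x; last by [].
- have [y /andP[dy yx] fE] := mvt d x d2 dx.
  by rewrite -subr_ge0 fE mulr_ge0 ?dfpos; lra.
- have [y /andP[xy yd] fE] := mvt x d x2 xd.
  by rewrite -subr_le0 fE mulr_le0_ge0 ?dfneg; lra.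
Qed.

End Entropy.

(** * The Moore bound for irregular graphs *)

Section MooreBound.

Variables (R : realType) (T : finType) (e : rel T) (S : {set T}).
Hypothesis (e_sym : symmetric e).
Let nb := nbhd e S.
Hypothesis min_deg : forall v, v \in S -> (2 <= #|nb v|)%N.

Let D v : R := #|nb v|%:R.

Let D2 v : v \in S -> 2 <= D v.
Proof. by move=> vS; rewrite ler_nat min_deg. Qed.

Let nb_S u v : v \in nb u -> v \in S.
Proof. by rewrite inE => /andP[]. Qed.

Let nb_sym u v : u \in S -> v \in nb u -> u \in nb v.
Proof. by move=> uS; rewrite !inE uS e_sym => /andP[]. Qed.

Let card_nbD1 v u : u \in nb v -> #|[pred w | (w \in nb v) && (w != u)]|%:R = D v - 1.
Proof.
move=> uv; rewrite /D (cardD1 u) uv natrD addrAC subrr add0r; congr _%:R.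
by apply: eq_card => w; rewrite !inE andbC.
Qed.

Let exchange_arcs (g : T -> T -> R) :
  \sum_(u in S) \sum_(v in nb u) g u v = \sum_(v in S) \sum_(u in nb v) g u v.
Proof.
rewrite (exchange_big_dep (mem S)) /=; last by move=> u v _ /nb_S.
apply: eq_bigr => v vS; apply: eq_bigl => u.
by rewrite !inE vS e_sym.
Qed.

Lemma nbw_gt0 j u v : u \in S -> v \in nb u -> (0 < nbw e S j u v)%N.
Proof.
elim: j u v => [|j IH] u v uS uv //=.
have vS := nb_S uv.
have [w] : exists w, (w \in nb v) && (w != u).
  apply/existsP; apply: contraT; rewrite negb_exists => /forallP h.
  have := card_nbD1 (nb_sym uS uv); rewrite eq_card0; first by have := D2 vS; lra.
  by move=> w; rewrite !inE; apply/negbTE; have := h w; rewrite inE.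
move=> wP; rewrite (bigD1 w) //= addn_gt0 IH //; by case/andP: wP.
Qed.

(* Jensen: [nbw j.+1 u v] is a sum of [D v - 1] terms [nbw j v w]. *)
Lemma ln_nbw_step j u v : u \in S -> v \in nb u ->
  ln (D v - 1) + (D v - 1)^-1 * \sum_(w in nb v | w != u) ln (nbw e S j v w)%:R
    <= ln (nbw e S j.+1 u v)%:R :> R.
Proof.
move=> uS uv; have vS := nb_S uv; have Dv := D2 vS.
have N0 : 0 < (nbw e S j.+1 u v)%:R :> R by rewrite ltr0n nbw_gt0.
have cardP := card_nbD1 (nb_sym uS uv).
have sumE : \sum_(w | (w \in nb v) && (w != u)) (nbw e S j v w)%:R =
    #|[pred w | (w \in nb v) && (w != u)]|%:R * ((nbw e S j.+1 u v)%:R / (D v - 1)).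
  by rewrite cardP mulrCA divff ?mulr1 ?natr_sum //; lra.
have F0 w : (w \in nb v) && (w != u) -> 0 < (nbw e S j v w)%:R :> R.
  by case/andP => wv _; rewrite ltr0n nbw_gt0.
move: N0 sumE; set N := (nbw e S j.+1 u v)%:R => N0 sumE.
have D1 : 0 < D v - 1 by lra.
have := sum_ln_le F0 (divr_gt0 N0 D1) sumE.
rewrite ln_div ?posrE // cardP => h.
by rewrite -lerBrDl ler_pdivrMl.
Qed.

(** In the Jensen step an arc [v w] collects the weight [(D v - 1)^-1] from its [D v - 1]
    predecessors [u], hence total weight 1; the term [ln (D v - 1)] occurs for each of the [D v]
    arcs ending at [v]. *)
Lemma sum_ln_nbw j :
  j%:R * \sum_(v in S) D v * ln (D v - 1) <=
  \sum_(u in S) \sum_(v in nb u) ln (nbw e S j u v)%:R :> R.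
Proof.
elim: j => [|j IH].
  by rewrite mul0r sumr_ge0 // => u _; rewrite sumr_ge0 // => v _; rewrite ln1.
rewrite -natr1 mulrDl mul1r; apply: le_trans (_ : _ <=
  \sum_(u in S) \sum_(v in nb u) (ln (D v - 1) + (D v - 1)^-1 *
    \sum_(w in nb v | w != u) ln (nbw e S j v w)%:R)) _; last first.
  by apply: ler_sum => u uS; apply: ler_sum => v uv; apply: ln_nbw_step.
apply: le_trans (lerD IH (lexx _)) _.
rewrite [leRHS]exchange_arcs -big_split /=; apply: ler_sum => v vS.
rewrite [leLHS]addrC. rewrite big_split /= sumr_const -mulr_natl -/(D v) lerD2l -mulr_sumr.
rewrite ler_pdivlMl; last by have := D2 vS; lra.
rewrite (exchange_big_dep (mem (nb v))) /=; last by move=> u w _ /andP[].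
rewrite mulr_sumr; apply: ler_sum => w wv.
rewrite sumr_const -[leRHS]mulr_natl -(card_nbD1 wv) le_eqVlt; apply/orP; left.
apply/eqP; congr (_%:R * _); apply: eq_card => u.
rewrite [LHS]inE [RHS]inE. by rewrite wv eq_sym.
Qed.

(** With [d] the mean degree, average over the [A] arcs: [ln] of the mean number of walks is at
    least the mean of [ln], which is at least [j ln (d - 1)] by convexity of [x ln (x - 1)]. *)
Lemma nbw_moore_bound j : (0 < #|S|)%N ->
  let A := (\sum_(v in S) #|nb v|)%N%:R : R in
  2 <= A / #|S|%:R /\
  A * (A / #|S|%:R - 1) ^+ j <= (\sum_(u in S) \sum_(v in nb u) nbw e S j u v)%N%:R.
Proof.
move=> S0 A; set n : R := #|S|%:R; have n0 : 0 < n by rewrite ltr0n.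
have AE : A = \sum_(v in S) D v by rewrite /A natr_sum.
have d2 : 2 <= A / n.
  rewrite ler_pdivlMr // AE mulrC mulr_natl -sumr_const.
  by apply: ler_sum => v; apply: D2.
split=> //; set N := (\sum_(u in S) _)%N; set d := A / n.
have A0 : 0 < A by rewrite -(divfK (lt0r_neq0 n0) A) mulr_gt0 //; lra.
pose P (p : T * T) := (p.1 \in S) && (p.2 \in nb p.1).
have sumP (F : T -> T -> R) : \sum_(u in S) \sum_(v in nb u) F u v = \sum_(p | P p) F p.1 p.2.
  by rewrite pair_big_dep.
have PA : #|P|%:R = A.
  by rewrite AE -sum1_card natr_sum -(sumP (fun _ _ => 1)); apply: eq_bigr => u _; rewrite sumr_const.
have NE : N%:R = \sum_(p | P p) (nbw e S j p.1 p.2)%:R :> R.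
  by rewrite -(sumP (fun u v => (nbw e S j u v)%:R)) natr_sum; apply: eq_bigr => u _; rewrite natr_sum.
have N0 : 0 < N%:R / A.
  rewrite divr_gt0 // NE.
  have : 0 < #|P|%:R :> R by rewrite PA.
  rewrite ltr0n => /card_gt0P[p Pp]; rewrite (bigD1 p) //=.
  have [pS pv] := andP Pp.
  by rewrite ltr_pwDl ?sumr_ge0 // ltr0n nbw_gt0.
have lnN : A * (j%:R * ln (d - 1)) <= A * ln (N%:R / A).
  rewrite -{2}PA; apply: le_trans (sum_ln_le (F := fun p => (nbw e S j p.1 p.2)%:R) _ N0 _).
  - rewrite -(sumP (fun u v => ln (nbw e S j u v)%:R)); apply: le_trans (sum_ln_nbw j).
    rewrite mulrCA ler_wpM2l //.
    (* The tangent terms cancel, as [d] is the mean degree. *)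
    have -> : A * ln (d - 1) = \sum_(v in S) (D v * ln (d - 1) + d / (d - 1) * (D v - d)).
      rewrite big_split /= -mulr_suml -AE -mulr_sumr sumrB -AE sumr_const -mulr_natr.
      by rewrite divfK ?gt_eqF // subrr mulr0 addr0.
    by apply: ler_sum => v vS; apply: xlnx1_tangent => //; apply: D2.
  - by move=> [u v] /andP[uS uv]; rewrite ltr0n nbw_gt0.
  - by rewrite PA mulrC divfK ?gt_eqF.
have d1 : 0 < d - 1 by rewrite subr_gt0; apply: lt_le_trans d2; rewrite (ltr_nat R 1).
rewrite mulrC -ler_pdivlMr // -ler_ln ?posrE ?exprn_gt0 //.
by rewrite lnXn // -[_ *+ j]mulr_natl -(ler_pM2l A0).
Qed.

End MooreBound.

(** * Real estimates for the upper bound *)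

Section Numeric.

Variable (R : realType).

Lemma bernoulli_ineq (x : R) (n : nat) : -1 <= x -> 1 + n%:R * x <= (1 + x) ^+ n.
Proof.
move=> x1; elim: n => [|n IH]; first by rewrite mul0r addr0.
rewrite exprS; apply: le_trans (ler_wpM2l _ IH); last by lra.
have : 0 <= n%:R * x ^+ 2 by rewrite mulr_ge0 // sqr_ge0.
by rewrite -natr1; lra.
Qed.

(** The right-hand side [d0], put for [d], already yields at least [t ^ k]. By Bernoulli this
    reduces to [1 <= (1 + a + b) (1 - a + (k - 1) b)], where the loss [a ^ 2 <= 1 / t ^ 2] is
    absorbed by [b = 2 / t ^ 2]; hence the term [2 / t]. *)
Lemma moore_degree_le (k : nat) (t d : R) : (2 <= k)%N -> 1 <= t -> 2 <= d ->
  d * (d - 1) ^+ k.-1 <= t ^+ k -> d <= t + (k%:R - 1) / k%:R + 2 / t.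
Proof.
move=> k2 t1 d2; apply: contraTT; rewrite -!ltNge.
have k_gt0 : (0 < k)%N by apply: ltnW.
have k1E : k.-1%:R = k%:R - 1 :> R by rewrite -subn1 natrB.
set d0 := t + _ + _ => dd0.
have k2R : 2 <= k%:R :> R by rewrite ler_nat.
pose a := (k%:R - 1) / (k%:R * t); pose b := 2 / t ^+ 2; pose z := - (k%:R * t)^-1 + b.
have t0 : t != 0 by lra.
have k0 : k%:R != 0 :> R by lra.
have kt0 : 0 < k%:R * t by apply: mulr_gt0; lra.
have d0E : d0 = t * (1 + a + b) by rewrite /d0 /a /b; field; rewrite t0 k0.
have d01E : d0 - 1 = t * (1 + z) by rewrite /d0 /z /b; field; rewrite t0 k0.
have a0 : 0 <= a by rewrite /a divr_ge0; lra.
have at1 : a * t <= 1.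
  by rewrite (_ : a * t = (k%:R - 1) / k%:R); [rewrite ler_pdivrMr; lra|rewrite /a; field; rewrite t0 k0].
have a1 : a <= 1 by apply: le_trans at1; rewrite ler_peMr.
have b0 : 0 < b by rewrite /b divr_gt0 ?exprn_gt0; lra.
have a2b : a ^+ 2 <= b.
  rewrite /b ler_pdivlMr; last by rewrite exprn_gt0; lra.
  have : 0 <= a * t by rewrite mulr_ge0; lra.
  by rewrite -exprMn; nra.
have z1 : -1 <= z.
  have : (k%:R * t)^-1 <= 1 by rewrite invf_le1 //; nra.
  by rewrite /z; lra.
have kz : k.-1%:R * z = - a + k.-1%:R * b.
  by rewrite k1E /z /a; field; rewrite t0 k0.
have k1 : 1 <= k.-1%:R :> R by rewrite k1E; lra.
have bern := bernoulli_ineq k.-1 z1.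
have key : t ^+ k <= d0 * (d0 - 1) ^+ k.-1.
  rewrite d01E d0E exprMn mulrACA -exprS prednK //.
  rewrite ler_peMr ?exprn_ge0 //; first lra.
  apply: le_trans (ler_wpM2l _ bern); last by lra.
  have : b <= k.-1%:R * b by rewrite ler_peMl // ltW.
  rewrite kz; move: (k.-1%:R * b) => c cb.
  have p1 : 0 <= (c - b) * (1 + a + b) by rewrite mulr_ge0; lra.
  have p2 : 0 <= b * (b + 1) by rewrite mulr_ge0; lra.
  rewrite -subr_ge0 (_ : _ - 1 = (c - b) * (1 + a + b) + b * (b + 1) + (b - a ^+ 2)); last by ring.
  lra.
have d01 : 0 < d0 - 1.
  rewrite d01E mulr_gt0; [|lra|]; rewrite //.
  have : (k%:R * t)^-1 < 1 by rewrite invf_lt1 //; nra.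
  by rewrite /z; lra.
apply: le_lt_trans key _.
apply: (@lt_le_trans _ _ (d * (d0 - 1) ^+ k.-1)); first by rewrite ltr_pM2r ?exprn_gt0.
by rewrite ler_wpM2l ?lerXn2r ?nnegrE; lra.
Qed.

Lemma powR_inv_expn (k n : nat) : (0 < k)%N -> (n%:R `^ k%:R^-1) ^+ k = n%:R :> R.
Proof.
move=> k0; rewrite -powR_mulrn ?powR_ge0 // -powRrM mulVf ?powRr1 //.
by rewrite pnatr_eq0 -lt0n.
Qed.

Lemma ge1_powR_inv (k n : nat) : (0 < n)%N -> 1 <= n%:R `^ k%:R^-1 :> R.
Proof.
move=> n0; have n1 : 1 <= n%:R :> R by rewrite (ler_nat R 1).
by have := ler_powR n1 (_ : 0 <= k%:R^-1); rewrite powRr0; apply; rewrite invr_ge0.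
Qed.

Lemma powR_1Dinv (k n : nat) : (0 < n)%N ->
  n%:R `^ (1 + k%:R^-1) = n%:R * n%:R `^ k%:R^-1 :> R.
Proof.
by move=> n0; rewrite powRD ?powRr1 // pnatr_eq0 -lt0n n0 implybT.
Qed.

Lemma powR_1Binv (k n : nat) : (0 < n)%N ->
  n%:R `^ (1 - k%:R^-1) = n%:R / n%:R `^ k%:R^-1 :> R.
Proof.
by move=> n0; rewrite powRB ?powRr1 // pnatr_eq0 -lt0n n0 implybT.
Qed.

(** Twice the upper bound of the theorem, since arcs count edges twice. *)
Definition arc_bound (k n : nat) : R :=
  n%:R `^ (1 + k%:R^-1) + (k%:R - 1) / k%:R * n%:R + 2 * n%:R `^ (1 - k%:R^-1).

Lemma arc_bound_ge0 k n : (0 < k)%N -> 0 <= arc_bound k n.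
Proof.
move=> k0; have : 1 <= k%:R :> R by rewrite (ler_nat R 1).
by move=> k1; rewrite !addr_ge0 ?mulr_ge0 ?powR_ge0 ?invr_ge0 //; lra.
Qed.

(** Makes room for a vertex of degree at most 1. The first term grows by at least [1 + 1/k], by
    Bernoulli for [(t / s) ^ k = n / (n + 1)], and the second by [1 - 1/k]. *)
Lemma arc_boundS k n : (2 <= k)%N -> (0 < n)%N ->
  arc_bound k n + 2 <= arc_bound k n.+1.
Proof.
move=> k2 n0; have k2R : 2 <= k%:R :> R by rewrite ler_nat.
have k_gt0 : (0 < k)%N by apply: ltnW.
rewrite /arc_bound !powR_1Dinv //.
have le2 : n%:R `^ (1 - k%:R^-1) <= n.+1%:R `^ (1 - k%:R^-1) :> R.
  apply: ge0_ler_powR; rewrite ?nnegrE ?ler_nat //.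
  by rewrite subr_ge0 invf_le1; lra.
move: le2; set p := n%:R `^ _; set p' := n.+1%:R `^ _ => le2.
set t := n%:R `^ k%:R^-1; set s := n.+1%:R `^ k%:R^-1.
have tk : t ^+ k = n%:R by rewrite powR_inv_expn.
have sk : s ^+ k = n%:R + 1 by rewrite powR_inv_expn // natr1.
have t1 : 1 <= t by apply: ge1_powR_inv.
have s1 : 1 <= s by apply: ge1_powR_inv.
have s0 : s != 0 by lra.
have ts0 : 0 <= t / s by rewrite divr_ge0; lra.
have ts1 : -1 <= t / s - 1 by lra.
have := bernoulli_ineq k ts1; rewrite (_ : 1 + (t / s - 1) = t / s); last by ring.
have n1 : 0 < n%:R + 1 :> R by rewrite natr1.
rewrite expr_div_n tk sk ler_pdivlMr //.
move=> bern.
have st : s / k%:R <= (n%:R + 1) * (s - t).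
  rewrite ler_pdivrMr; last lra.
  have : (1 + k%:R * (t / s - 1)) * (n%:R + 1) * s <= n%:R * s by rewrite ler_wpM2r; lra.
  rewrite (_ : _ * s = (n%:R + 1) * s - (n%:R + 1) * (s - t) * k%:R); first lra.
  by field.
have : 1 / k%:R <= s / k%:R by rewrite ler_pM2r // invr_gt0; lra.
rewrite (_ : (k%:R - 1) / k%:R = 1 - 1 / k%:R); last by field; lra.
by rewrite -[n.+1%:R]natr1; lra.
Qed.

End Numeric.

(** * From walk counts to the bound on edges *)

Section UpperBound.

Variables (R : realType) (T : finType) (e : rel T) (k : nat).
Hypothesis (e_sym : symmetric e) (e_irr : irreflexive e) (k2 : (2 <= k)%N).
Hypothesis (e_free : forall m, forbidden k m -> ~ has_cycle e m).

Implicit Type S : {set T}.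

(** With [d = A / n], uniqueness of walks and the Moore bound give [n d (d - 1) ^ (k - 1) <= n ^ 2];
    then [moore_degree_le] applies with [t ^ k = n]. *)
Lemma arcs_le_min_deg2 S : (0 < #|S|)%N ->
  (forall v, v \in S -> (2 <= #|nbhd e S v|)%N) ->
  (arcs e S)%:R <= arc_bound R k #|S|.
Proof.
move=> S0 D2; have [] := @nbw_moore_bound R T e S e_sym D2 k.-1 S0.
rewrite -/(arcs e S); set A := (arcs e S)%:R : R; set n : R := #|S|%:R => d2 moore.
have n0 : 0 < n by rewrite ltr0n.
have nn : n != 0 by rewrite lt0r_neq0.
have k0 : (0 < k)%N by apply: ltnW.
have le2 : (\sum_(u in S) \sum_(v in nbhd e S u) nbw e S k.-1 u v <= #|S| ^ 2)%N.
  apply: sum_nbw_le; rewrite prednK // => x y xw yw xy0 xyk i ik.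
  exact: (nb_walk_unique e_irr e_sym xw yw xy0 xyk e_free).
have {}moore : A * (A / n - 1) ^+ k.-1 <= n ^+ 2.
  by apply: le_trans moore _; rewrite /n -natrX ler_nat.
have t1 : 1 <= #|S|%:R `^ k%:R^-1 :> R by apply: ge1_powR_inv.
have := @moore_degree_le R k (#|S|%:R `^ k%:R^-1) (A / n) k2 t1 d2.
rewrite powR_inv_expn // -/n mulrAC ler_pdivrMr // -expr2 => /(_ moore) h.
rewrite /arc_bound powR_1Dinv ?powR_1Binv // -/n.
rewrite -(divfK nn A); apply: le_trans (ler_wpM2r (ltW n0) h) _.
by rewrite le_eqVlt; apply/orP; left; apply/eqP; ring.
Qed.

Lemma arcsD1 S v : v \in S -> (arcs e S <= arcs e (S :\ v) + 2 * #|nbhd e S v|)%N.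
Proof.
move=> vS; rewrite /arcs (bigD1 v) //= mul2n -addnn addnCA leq_add2l.
rewrite (eq_bigl (fun u => u \in S :\ v)); last by move=> u; rewrite !inE andbC.
have -> : #|nbhd e S v| = (\sum_(u in S :\ v) (e u v : nat))%N.
  rewrite -sum1_card big_mkcond [RHS]big_mkcond /=; apply: eq_bigr => u _.
  rewrite !inE e_sym; case: eqVneq => [->|] /=; first by rewrite e_irr andbF.
  by case: (u \in S) => //=; case: (e u v).
rewrite -big_split /=; apply: leq_sum => u uS.
rewrite (cardsD1 v (nbhd e S u)) addnC leq_add //; last by rewrite inE vS.
by apply: subset_leq_card; apply/fintype.subsetP => w; rewrite !inE => /and3P[-> -> ->].
Qed.

(** Vertices of degree at most 1 are removed one by one; each costs at most 2 arcs, which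
    [arc_boundS] pays for. *)
Lemma arcs_le S : (0 < #|S|)%N -> (arcs e S)%:R <= arc_bound R k #|S|.
Proof.
have [n] := ubnP #|S|; elim: n S => // n IH S Sn S0.
case: (pselect (forall v, v \in S -> (2 <= #|nbhd e S v|)%N)) => [D2|].
  exact: arcs_le_min_deg2.
move=> /existsNP[v /not_implyP[vS /negP]]; rewrite -ltnNge ltnS => dv.
have SE : #|S| = #|S :\ v|.+1 by rewrite (cardsD1 v S) vS.
have Av := arcsD1 vS.
have [S'0|S'0] := posnP #|S :\ v|.
  have -> : arcs e S = 0%N; last by apply: arc_bound_ge0; lia.
  have SE' : S = [set v]%SET.
    apply/eqP; rewrite eqEcard cards1 SE S'0 andbT.
    apply/fintype.subsetP => w wS; rewrite inE; apply: contraT => wv.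
    by move: S'0; rewrite (cardsD1 w) !inE wv wS.
  rewrite /arcs SE' big_set1; apply/eqP; rewrite cards_eq0; apply/eqP/setP => w.
  by rewrite !inE; case: eqVneq => // ->; rewrite e_irr.
rewrite SE; apply: le_trans (arc_boundS R k2 S'0).
have {}IH := IH _ (_ : (#|S :\ v| < n)%N) S'0.
apply: le_trans (_ : (arcs e (S :\ v) + 2)%:R <= _); first by rewrite ler_nat; lia.
by rewrite natrD lerD2r; apply: IH; lia.
Qed.

End UpperBound.

Lemma ex_upper_bound (R : realType) (k n : nat) : (2 <= k)%N -> (1 <= n)%N ->
  (ex n (even_cycles k `|` short_cycles k)%classic)%:R <=
       2^-1 * n%:R `^ (1 + k%:R^-1) + (k%:R - 1) / (2 * k%:R) * n%:R
       + n%:R `^ (1 - k%:R^-1) :> R.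
Proof.
move=> k2 n1; have k0 : k%:R != 0 :> R by rewrite pnatr_eq0 -lt0n ltnW.
rewrite (_ : _ + _ = 2^-1 * arc_bound R k n); last by rewrite /arc_bound; field.
rewrite mulrC ler_pdivlMr //.
apply: (big_ind (fun x => x%:R * 2 <= arc_bound R k n)).
- by rewrite mul0r arc_bound_ge0 // ltnW.
- by move=> x y hx hy; rewrite /maxn; case: ifP.
move=> G /asboolP /family_freeP free.
have := @arcs_le R _ (adj G) k (@adj_sym n G) (@adj_irr n G) k2 free [set: 'I_n]%SET.
by rewrite cardsT card_ord arcs_edges natrM mulrC; apply.
Qed.

(** * Leaf relations coming from self-polar generalized polygons *)

Section Directions.

Variable (F : fieldType).

(* Homogeneous coordinates: [Some a] is (1 : a) and [None] is (0 : 1). *)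
Definition dir0 (p : option F) : F := if p is Some _ then 1 else 0.
Definition dir1 (p : option F) : F := if p is Some a then a else 1.
Definition dir_det (p q : option F) : F := dir0 p * dir1 q - dir0 q * dir1 p.

Lemma dir_det_eq0 p q : (dir_det p q == 0) = (p == q).
Proof.
rewrite /dir_det; case: p q => [a|] [b|] /=; rewrite ?mul1r ?mul0r ?mulr1.
- by rewrite subr_eq0 eq_sym.
- by rewrite subr0 oner_eq0.
- by rewrite sub0r oppr_eq0 oner_eq0.
- by rewrite subrr !eqxx.
Qed.

Lemma dir_detC p q : dir_det q p = - dir_det p q.
Proof. by rewrite /dir_det opprB. Qed.

(** Prepares for [ring] in characteristic 3: [3 w] is the explicit difference of the two sides. *)
Lemma eq_mod3 (u v w : F) : 3%:R = 0 :> F -> u = v + 3%:R * w -> u = v.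
Proof. by move=> ->; rewrite mul0r addr0. Qed.

Lemma char3_cube_det (p q : option F) : 3%:R = 0 :> F ->
  dir0 p ^+ 3 * dir1 q ^+ 3 - dir0 q ^+ 3 * dir1 p ^+ 3 = dir_det p q ^+ 3.
Proof.
move=> h3; rewrite /dir_det.
move: (dir0 p) (dir1 p) (dir0 q) (dir1 q) => s t s' t'.
by apply: (eq_mod3 (w := s * t' * s' * t * (s * t' - s' * t)) h3); ring.
Qed.

End Directions.

(** * The case [k = 5]: the split Cayley hexagon *)

Section Hexagon.

Variables (F : fieldType) (sigma : {rmorphism F -> F}).
Hypothesis char3 : 3%:R = 0 :> F.
Hypothesis sigma2 : forall x, sigma (sigma x) = x ^+ 3.

(* Self-polar form of the split Cayley hexagon in coordinates. *)
Definition leaf5 : rel (seq F) := fun x y =>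
  [&& size x == 5%N, size y == 5%N,
      x`_4 + y`_1 == x`_0 * sigma y`_0,
      x`_1 + y`_4 == sigma x`_0 * y`_0,
      x`_2 + y`_3 == x`_0 ^+ 2 * sigma y`_0 + x`_0 * y`_1 &
      x`_3 + y`_2 == sigma x`_0 * y`_0 ^+ 2 + y`_0 * x`_1].

Lemma seq5E (x : seq F) : size x = 5%N -> x = [:: x`_0; x`_1; x`_2; x`_3; x`_4].
Proof. by case: x => [|? [|? [|? [|? [|? []]]]]]. Qed.

Lemma leaf5_size x y : leaf5 x y -> size x = 5%N /\ size y = 5%N.
Proof. by case/and3P => /eqP-> /eqP->. Qed.

Lemma leaf5_sym : symmetric leaf5.
Proof.
move=> x y; rewrite /leaf5 andbCA; congr [&& _, _ & _].
rewrite [y`_4 + _]addrC [y`_1 + _]addrC [y`_2 + _]addrC [y`_3 + _]addrC.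
rewrite [y`_0 * sigma _]mulrC [sigma y`_0 * x`_0]mulrC [y`_0 ^+ 2 * _]mulrC [sigma y`_0 * x`_0 ^+ 2]mulrC.
by rewrite andbCA; congr [&& _, _ & _]; rewrite andbC.
Qed.

Lemma leaf5E x y : leaf5 x y -> [/\ size x = 5%N, size y = 5%N,
  y`_1 = x`_0 * sigma y`_0 - x`_4,
  y`_4 = sigma x`_0 * y`_0 - x`_1 &
  y`_3 = x`_0 ^+ 2 * sigma y`_0 + x`_0 * y`_1 - x`_2 /\
  y`_2 = sigma x`_0 * y`_0 ^+ 2 + y`_0 * x`_1 - x`_3].
Proof.
case/and3P => /eqP sx /eqP sy /and4P[/eqP<- /eqP<- /eqP<- /eqP<-].
by split=> //; rewrite ![x`__ + _]addrC ?addrK.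
Qed.

Lemma leaf5_inj x y y' : leaf5 x y -> leaf5 x y' -> y`_0 = y'`_0 -> y = y'.
Proof.
move=> /leaf5E[_ sy y1 y4 [y3 y2]] /leaf5E[_ sy' y1' y4' [y3' y2']] y0.
by rewrite (seq5E sy) (seq5E sy') y2 y2' y3 y3' y4 y4' y1 y1' y0.
Qed.

Notation crdA y := (sigma y`_0).
Notation crdB y := (y`_1).
Notation crdC y := (- y`_3).
Notation crdD y := (sigma y`_4).
(** The symplectic coordinate: a jump of height at most 2 changes it by [D dA - A dD], so a closed
    chain of such jumps encloses zero area in the [(A, D)] plane. *)
Notation crdZ y := (sigma (y`_2 - y`_0 * y`_4)).

(* In the coordinates (A, B, C, D) the jumps of height 1 are multiples of the
   points (s^3, s^2 t, s t^2, t^3) of a twisted cubic, whose tangent at (s : t)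
   is spanned in characteristic 3 by that point and (0, s, -t, 0). *)
Definition disp (h : nat) (p : option F) (y y' : seq F) : Prop :=
  exists kap mu, [/\ crdA y' - crdA y = kap * dir0 p ^+ 3,
    crdD y' - crdD y = kap * dir1 p ^+ 3,
    (h <= 3)%N -> crdB y' - crdB y = kap * dir0 p ^+ 2 * dir1 p + mu * dir0 p /\
                  crdC y' - crdC y = kap * dir0 p * dir1 p ^+ 2 - mu * dir1 p,
    (h <= 2)%N -> ~ (kap = 0 /\ mu = 0) /\
       crdZ y' - crdZ y = crdD y * (crdA y' - crdA y) - crdA y * (crdD y' - crdD y)
   & (h <= 1)%N -> mu = 0].

Lemma nth_take_eq (x x' : seq F) m i : take m x = take m x' -> (i < m)%N -> x`_i = x'`_i.
Proof. by move=> tx im; rewrite -(nth_take _ im) tx nth_take. Qed.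

(** In direction [None] the leaves themselves share [5 - h] letters. In direction [Some a] the
    adjacent leaves [x] and [x'] share [6 - h], and [leaf5E] turns this into a displacement of [y];
    the cube in [D] comes from [sigma2]. *)
Lemma disp_of_jump p h y y' : (0 < h <= 4)%N -> jump 0 5 leaf5 p h y y' -> disp h p y y'.
Proof.
move=> /andP[h0 h4] [sy sy' yy'].
have inj : crdA y = crdA y' -> crdB y = crdB y' -> crdC y = crdC y' ->
    crdD y = crdD y' -> y`_2 = y'`_2 -> False.
  move=> /fmorph_inj e0 e1 /oppr_inj e3 /fmorph_inj e4 e2; case/eqP: yy'.
  by rewrite (seq5E sy) (seq5E sy') e0 e1 e2 e3 e4.
rewrite /disp; case: p => [a|] /=; last first.
  move=> ty; have nt i : (i < 5 - h)%N -> y`_i = y'`_i by apply: nth_take_eq.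
  have y0 : y`_0 = y'`_0 by apply: nt; lia.
  exists (crdD y' - crdD y), (y'`_3 - y`_3); split.
  - by rewrite y0; ring.
  - by ring.
  - move=> h3; have y1 : y`_1 = y'`_1 by apply: nt; lia.
    by rewrite y1; split; ring.
  - move=> h2; have y1 : y`_1 = y'`_1 by apply: nt; lia.
    have y2 : y`_2 = y'`_2 by apply: nt; lia.
    rewrite y0 y2; split; last by rewrite !rmorphB !rmorphM; ring.
    move=> [k0 m0]; apply: inj; rewrite ?y0 ?y1 //.
      by congr (- _); apply/eqP; rewrite eq_sym -subr_eq0 m0.
    by apply/eqP; rewrite eq_sym -subr_eq0 k0.
  - by move=> h1; rewrite (nt 3%N) ?subrr //; lia.
move=> [x [x' [[xy x'y'] xa x'a tx]]].
have nt i : (i < 5 - h.-1)%N -> x`_i = x'`_i by apply: nth_take_eq.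
have [_ _ y1 y4 [y3 y2]] := leaf5E xy; have [_ _ y1' y4' [y3' y2']] := leaf5E x'y'.
rewrite xa in y1 y4 y3 y2; rewrite x'a in y1' y4' y3' y2'.
have x1 : x`_1 = x'`_1 by apply: nt; lia.
have BE : crdB y' - crdB y = (crdA y' - crdA y) * 1 ^+ 2 * a + (x`_4 - x'`_4) * 1.
  by rewrite y1 y1'; ring.
exists (crdA y' - crdA y), (x`_4 - x'`_4); split.
- by ring.
- by rewrite y4 y4' x1 !rmorphB !rmorphM sigma2; ring.
- move=> h3; split=> //; have x2 : x`_2 = x'`_2 by apply: nt; lia.
  apply: (eq_mod3 (w := - (a ^+ 2 * (crdA y' - crdA y))) char3).
  by rewrite y3 y3' x2 y1 y1'; ring.
- move=> h2; have x2 : x`_2 = x'`_2 by apply: nt; lia.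
  have x3 : x`_3 = x'`_3 by apply: nt; lia.
  split.
    move=> [k0 m0]; have A0 : crdA y = crdA y' by apply/eqP; rewrite eq_sym -subr_eq0 k0.
    have x4 : x`_4 = x'`_4 by apply/eqP; rewrite -subr_eq0 m0.
    have y0 : y`_0 = y'`_0 by apply: fmorph_inj A0.
    have y1E : y`_1 = y'`_1 by rewrite y1 y1' A0 x4.
    by apply: inj => //; rewrite ?y3 ?y3' ?y4 ?y4' ?y2 ?y2' ?y1E ?A0 ?y0 ?x1 ?x2 ?x3.
  rewrite -!rmorphB -!rmorphM -!rmorphB; congr (sigma _).
  apply: (eq_mod3 (w := x'`_1 * (y'`_0 - y`_0)) char3).
  by rewrite y2 y2' y4 y4' x1 x3; ring.
- by move=> h1; rewrite (nt 4%N) ?subrr //; lia.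
Qed.

(* The cubic form vanishing at the directions a, b, c, applied to the vector
   (A, B, C, D), where (s^3, s^2 t, s t^2, t^3) evaluates it at (s : t). *)
Definition cubic (a b c : option F) (y : seq F) : F :=
  dir1 a * dir1 b * dir1 c * crdA y
  - (dir0 a * dir1 b * dir1 c + dir1 a * dir0 b * dir1 c + dir1 a * dir1 b * dir0 c) * crdB y
  + (dir1 a * dir0 b * dir0 c + dir0 a * dir1 b * dir0 c + dir0 a * dir0 b * dir1 c) * crdC y
  - dir0 a * dir0 b * dir0 c * crdD y.

(** Height 1 moves along a point of the curve itself, where the form factors into brackets. *)
Lemma disp1_cubic h p y y' : disp h p y y' -> (h <= 1)%N ->
  exists kap, [/\ kap != 0, crdA y' = crdA y + kap * dir0 p ^+ 3,
    crdD y' = crdD y + kap * dir1 p ^+ 3,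
    crdZ y' = crdZ y + (crdD y * (kap * dir0 p ^+ 3) - crdA y * (kap * dir1 p ^+ 3)) &
    forall a b c, cubic a b c y' = cubic a b c y + kap * (dir_det p a * dir_det p b * dir_det p c)].
Proof.
move=> [kap [mu [dA dD h3 h2 h1]]] hle.
have [dB dC] := h3 (leq_trans hle (isT : (1 <= 3)%N)); have [nz dZ] := h2 (leq_trans hle (isT : (1 <= 2)%N)).
have mu0 := h1 hle; rewrite mu0 !mul0r addr0 subr0 in dB dC.
exists kap; split.
- by apply/eqP => k0; apply: nz.
- by rewrite -dA addrC subrK.
- by rewrite -dD addrC subrK.
- by rewrite -dA -dD -dZ [RHS]addrC subrK.
move=> a b c; apply/eqP; rewrite addrC -subr_eq; apply/eqP.
transitivity (dir1 a * dir1 b * dir1 c * (crdA y' - crdA y)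
  - (dir0 a * dir1 b * dir1 c + dir1 a * dir0 b * dir1 c + dir1 a * dir1 b * dir0 c) * (crdB y' - crdB y)
  + (dir1 a * dir0 b * dir0 c + dir0 a * dir1 b * dir0 c + dir0 a * dir0 b * dir1 c) * (crdC y' - crdC y)
  - dir0 a * dir0 b * dir0 c * (crdD y' - crdD y)); first by rewrite /cubic; ring.
by rewrite dA dB dC dD /dir_det; ring.
Qed.

(** A form with a double zero at [p] vanishes on the tangent at [p]. *)
Lemma disp3_cubic h p y y' c : disp h p y y' -> (h <= 3)%N -> cubic p p c y' = cubic p p c y.
Proof.
move=> [kap [mu [dA dD h3 _ _]]] hle; have [dB dC] := h3 hle.
apply/eqP; rewrite -subr_eq0; apply/eqP.
transitivity (dir1 p * dir1 p * dir1 c * (crdA y' - crdA y)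
  - (dir0 p * dir1 p * dir1 c + dir1 p * dir0 p * dir1 c + dir1 p * dir1 p * dir0 c) * (crdB y' - crdB y)
  + (dir1 p * dir0 p * dir0 c + dir0 p * dir1 p * dir0 c + dir0 p * dir0 p * dir1 c) * (crdC y' - crdC y)
  - dir0 p * dir0 p * dir0 c * (crdD y' - crdD y)); first by rewrite /cubic; ring.
rewrite dA dB dC dD.
by apply: (eq_mod3 (w := - mu * (dir0 p ^+ 2 * dir1 p * dir1 c + dir0 p * dir1 p ^+ 2 * dir0 c)) char3); ring.
Qed.

(** The determinant of the two vectors of cubes is the cube of the bracket. *)
Lemma cubes_free p q (k1 k2 : F) : p != q ->
  k1 * dir0 p ^+ 3 + k2 * dir0 q ^+ 3 = 0 ->
  k1 * dir1 p ^+ 3 + k2 * dir1 q ^+ 3 = 0 -> k1 = 0.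
Proof.
move=> pq e0 e1; have : k1 * dir_det p q ^+ 3 = 0.
  rewrite -char3_cube_det // -[RHS](subrr 0) -[X in _ = X - _](mulr0 (dir1 q ^+ 3)).
  by rewrite -[X in _ = _ - X](mulr0 (dir0 q ^+ 3)) -{1}e0 -e1; ring.
by move/eqP; rewrite mulf_eq0 expf_eq0 /= dir_det_eq0 (negbTE pq) orbF => /eqP.
Qed.

Lemma no_chain_1_4 h1 h2 p q y1 y2 : disp h1 p y1 y2 -> disp h2 q y2 y1 ->
  (h1 <= 1)%N -> p != q -> False.
Proof.
move=> d1 [k2 [m2 [dA2 dD2 _ _ _]]] hle pq.
have [k1 [k1n A2 D2 _ _]] := disp1_cubic d1 hle.
case/eqP: k1n; apply: (cubes_free pq (k2 := k2)).
  by rewrite -dA2 A2; ring.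
by rewrite -dD2 D2; ring.
Qed.

(** [A] and [D] force both [kap] to vanish; then [B] and [C] force the first [mu] to vanish, which
    height at most 2 forbids. *)
Lemma no_chain_2_3 h1 h2 p q y1 y2 : disp h1 p y1 y2 -> disp h2 q y2 y1 ->
  (h1 <= 2)%N -> (h2 <= 3)%N -> p != q -> False.
Proof.
move=> [k1 [m1 [dA1 dD1 h31 h21 _]]] [k2 [m2 [dA2 dD2 h32 _ _]]] hle1 hle2 pq.
have [dB1 dC1] := h31 (leq_trans hle1 (isT : (2 <= 3)%N)); have [dB2 dC2] := h32 hle2.
have [nz _] := h21 hle1.
have e0 : k1 * dir0 p ^+ 3 + k2 * dir0 q ^+ 3 = 0 by rewrite -dA1 -dA2; ring.
have e1 : k1 * dir1 p ^+ 3 + k2 * dir1 q ^+ 3 = 0 by rewrite -dD1 -dD2; ring.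
have k10 := cubes_free pq e0 e1.
have k20 : k2 = 0 by apply: (@cubes_free q p k2 k1); rewrite 1?eq_sym // addrC.
apply: nz; split=> //.
rewrite k10 k20 !mul0r !add0r in dB1 dC1 dB2 dC2.
have : m1 * dir_det p q = 0.
  have eB : m1 * dir0 p + m2 * dir0 q = 0 by rewrite -dB1 -dB2; ring.
  have eC : m1 * dir1 p + m2 * dir1 q = 0.
    by rewrite -[m1 * _]opprK -[m2 * _]opprK -dC1 -dC2; ring.
  transitivity (dir1 q * (m1 * dir0 p + m2 * dir0 q) - dir0 q * (m1 * dir1 p + m2 * dir1 q)).
    by rewrite /dir_det; ring.
  by rewrite eB eC !mulr0 subrr.
by move/eqP; rewrite mulf_eq0 dir_det_eq0 (negbTE pq) orbF => /eqP.
Qed.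

Let nz3 p q r r' (k : F) : k != 0 -> p != q -> p != r -> p != r' ->
  k * (dir_det p q * dir_det p r * dir_det p r') != 0.
Proof. by move=> k0 pq pr pr'; rewrite !mulf_neq0 // dir_det_eq0. Qed.

(** The form with a double zero at [r] and a zero at [q] is changed by the first jump only. *)
Lemma no_chain_1_1_3 h1 h2 h3 p q r y1 y2 y3 :
  disp h1 p y1 y2 -> disp h2 q y2 y3 -> disp h3 r y3 y1 ->
  (h1 <= 1)%N -> (h2 <= 1)%N -> (h3 <= 3)%N -> p != q -> r != p -> False.
Proof.
move=> d1 d2 d3 hle1 hle2 hle3 pq rp.
have [k1 [k1n _ _ _ L1]] := disp1_cubic d1 hle1.
have [k2 [k2n _ _ _ L2]] := disp1_cubic d2 hle2.
have pr : p != r by rewrite eq_sym.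
have := nz3 k1n pr pr pq; rewrite (_ : _ * _ = 0) ?eqxx //.
have := disp3_cubic q d3 hle3; rewrite L2 L1 (_ : dir_det q q = 0) ?mulr0 ?addr0; last by rewrite /dir_det subrr.
by move=> e; apply: (@addrI _ (cubic r r q y1)); rewrite addr0 -e.
Qed.

(* Only the coordinates A, D and Z matter here: the first two give
   k1 w1 + k2 w2 + k3 w3 = 0 in the plane and Z then forces the area k1 k2 [w1 w2] to vanish. *)
Lemma no_chain_1_2_2 h1 h2 h3 p q r y1 y2 y3 :
  disp h1 p y1 y2 -> disp h2 q y2 y3 -> disp h3 r y3 y1 ->
  (h1 <= 1)%N -> (h2 <= 2)%N -> (h3 <= 2)%N -> p != q -> r != p -> False.
Proof.
move=> d1 [k2 [m2 [dA2 dD2 _ h22 _]]] [k3 [m3 [dA3 dD3 _ h23 _]]] hle1 hle2 hle3 pq rp.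
have [k1 [k1n A2 D2 Z2 _]] := disp1_cubic d1 hle1.
have [_ dZ2] := h22 hle2; have [_ dZ3] := h23 hle3.
have e0 : k1 * dir0 p ^+ 3 + k2 * dir0 q ^+ 3 + k3 * dir0 r ^+ 3 = 0.
  by rewrite -dA2 -dA3 A2; ring.
have e1 : k1 * dir1 p ^+ 3 + k2 * dir1 q ^+ 3 + k3 * dir1 r ^+ 3 = 0.
  by rewrite -dD2 -dD3 D2; ring.
have area : k1 * k2 * dir_det p q ^+ 3 = 0.
  rewrite -char3_cube_det //.
  have : (crdZ y3 - crdZ y2) + (crdZ y1 - crdZ y3) + (crdZ y2 - crdZ y1) = 0 by ring.
  rewrite dZ2 dZ3 {}Z2 dA2 dD2 dA3 dD3.
  have -> : crdA y3 = crdA y2 + k2 * dir0 q ^+ 3 by rewrite -dA2 addrC subrK.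
  have -> : crdD y3 = crdD y2 + k2 * dir1 q ^+ 3 by rewrite -dD2 addrC subrK.
  rewrite A2 D2.
  have -> : k3 * dir0 r ^+ 3 = - (k1 * dir0 p ^+ 3 + k2 * dir0 q ^+ 3).
    by rewrite -[RHS]add0r -e0; ring.
  have -> : k3 * dir1 r ^+ 3 = - (k1 * dir1 p ^+ 3 + k2 * dir1 q ^+ 3).
    by rewrite -[RHS]add0r -e1; ring.
  move=> e; rewrite -[LHS]opprK -[RHS]oppr0 -[in RHS]e; ring.
move: area => /eqP; rewrite mulf_eq0 mulf_eq0 expf_eq0 (negbTE k1n) /= dir_det_eq0 (negbTE pq) orbF.
move=> /eqP k20; rewrite k20 !mul0r !addr0 in e0 e1.
by case/eqP: k1n; apply: cubes_free e0 e1; rewrite eq_sym.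
Qed.

Let mulf_eq0r (k x : F) : k * x = 0 -> x != 0 -> k = 0.
Proof. by move=> /eqP; rewrite mulf_eq0 => /orP[/eqP//|->]. Qed.

(** The letters are brackets: [a = [p q]], [b = [p r]], [c = [q r]], [x = [p u]], [y = [q u]], [z =
    [r u]]. The two linear relations eliminate [k1] and [k3] from the area. *)
Let area4 (a b c x y z k1 k2 k3 : F) : b * y = a * z + c * x ->
  k1 * (x ^+ 2 * b) + k2 * (y ^+ 2 * c) = 0 ->
  k2 * (y ^+ 2 * a) + k3 * (z ^+ 2 * b) = 0 ->
  k1 * k2 * a ^+ 3 + k1 * k3 * b ^+ 3 + k2 * k3 * c ^+ 3 = 0 ->
  2%:R * (k2 ^+ 2 * y ^+ 2 * a * b * c * (a * z * c * x)) = 0.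
Proof.
move=> pl e1 e3 area.
have {}e1 : k1 * (x ^+ 2 * b) = - (k2 * (y ^+ 2 * c)) by apply/eqP; rewrite -addr_eq0 e1.
have {}e3 : k3 * (z ^+ 2 * b) = - (k2 * (y ^+ 2 * a)) by apply/eqP; rewrite -addr_eq0 addrC e3.
transitivity ((k1 * k2 * a ^+ 3 + k1 * k3 * b ^+ 3 + k2 * k3 * c ^+ 3) * (x ^+ 2 * b) * (z ^+ 2 * b));
  last by rewrite area !mul0r.
transitivity (k2 * a ^+ 3 * (z ^+ 2 * b) * (k1 * (x ^+ 2 * b))
  + b ^+ 3 * (k1 * (x ^+ 2 * b)) * (k3 * (z ^+ 2 * b))
  + k2 * c ^+ 3 * (x ^+ 2 * b) * (k3 * (z ^+ 2 * b))); last by ring.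
rewrite e1 e3.
transitivity (k2 ^+ 2 * y ^+ 2 * a * b * c * ((b * y) ^+ 2 - (a * z) ^+ 2 - (c * x) ^+ 2));
  last by ring.
by rewrite pl; ring.
Qed.

(* The Pluecker relation turns the area into 2 [p q] [r u] [p u] [q r]. *)
Lemma no_chain_1_1_1_2 h1 h2 h3 h4 p q r u y1 y2 y3 y4 :
  disp h1 p y1 y2 -> disp h2 q y2 y3 -> disp h3 r y3 y4 -> disp h4 u y4 y1 ->
  (h1 <= 1)%N -> (h2 <= 1)%N -> (h3 <= 1)%N -> (h4 <= 2)%N ->
  p != q -> q != r -> r != u -> u != p -> False.
Proof.
move=> d1 d2 d3 d4 hle1 hle2 hle3 hle4 pq qr ru up.
have [k1 [k1n A2 D2 Z2 L1]] := disp1_cubic d1 hle1.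
have [k2 [k2n A3 D3 Z3 L2]] := disp1_cubic d2 hle2.
have [k3 [k3n A4 D4 Z4 L3]] := disp1_cubic d3 hle3.
(* Forms with a double zero at [u] are unchanged by the last jump. *)
have L c : k1 * (dir_det p u ^+ 2 * dir_det p c) + k2 * (dir_det q u ^+ 2 * dir_det q c) +
    k3 * (dir_det r u ^+ 2 * dir_det r c) = 0.
  have := disp3_cubic c d4 (leq_trans hle4 (isT : (2 <= 3)%N)); rewrite L3 L2 L1 => e.
  by apply: (@addrI _ (cubic u u c y1)); rewrite addr0 [RHS]e; ring.
have [k4 [m4 [dA4 dD4 _ h24 _]]] := d4.
have [_ dZ4] := h24 hle4.
have two : 2%:R != 0 :> F.
  by apply/eqP => t0; move/eqP: char3; rewrite -natr1 t0 add0r oner_eq0.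
have area : k1 * k2 * dir_det p q ^+ 3 + k1 * k3 * dir_det p r ^+ 3 + k2 * k3 * dir_det q r ^+ 3 = 0.
  rewrite -!char3_cube_det //.
  have : (crdZ y1 - crdZ y4) + (crdZ y4 - crdZ y1) = 0 by ring.
  rewrite dZ4 {}Z4 {}Z3 {}Z2 !(D4, D3, D2, A4, A3, A2).
  move=> e; rewrite -[LHS]opprK -[RHS]oppr0 -[in RHS]e; ring.
have det0 (v : option F) : dir_det v v = 0 by rewrite /dir_det subrr.
(* Coincidences first: if [p = r] and [q = u], the area is [2 k1 k2 [p q] ^ 3]; with just one
   coincidence a form isolates a single jump. *)
have [pr|pr] := eqVneq p r.
  have [qu|qu] := eqVneq q u.
    rewrite -pr -qu in dA4 dD4 D4 A4 area.
    have k13 : k1 + k3 = 0.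
      apply: (cubes_free (k2 := k2 + k4) pq).
        by rewrite mulrDl [(k2 + _) * _]mulrDl -dA4 A4 A3 A2; ring.
      by rewrite mulrDl [(k2 + _) * _]mulrDl -dD4 D4 D3 D2; ring.
    have {}k13 : k3 = - k1 by apply/eqP; rewrite -addr_eq0 addrC k13.
    have : 2%:R * (k1 * k2 * dir_det p q ^+ 3) == 0.
      by rewrite -area k13 [dir_det q p]dir_detC det0; apply/eqP; ring.
    by apply/negP; rewrite !mulf_neq0 ?expf_neq0 // dir_det_eq0.
  have := L p; rewrite -pr det0 ?mulr0 ?addr0 ?add0r.
  move=> /mulf_eq0r k20; case/eqP: k2n; apply: k20.
  by rewrite mulf_neq0 ?expf_neq0 // dir_det_eq0 // eq_sym.
have [qu|qu] := eqVneq q u.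
  have := L r; rewrite qu !det0 expr0n /= mul0r !mulr0 !addr0.
  move=> /mulf_eq0r k10; case/eqP: k1n; apply: k10.
  by rewrite mulf_neq0 ?expf_neq0 // dir_det_eq0 // eq_sym.
have pl : dir_det p r * dir_det q u = dir_det p q * dir_det r u + dir_det q r * dir_det p u.
  by rewrite /dir_det; ring.
have e1 := L r; rewrite det0 !mulr0 addr0 in e1.
have e3 : k2 * (dir_det q u ^+ 2 * dir_det p q) + k3 * (dir_det r u ^+ 2 * dir_det p r) = 0.
  rewrite -[RHS]oppr0 -[in RHS](L p) det0 !mulr0 add0r (dir_detC p q) (dir_detC p r); ring.
have /eqP := area4 pl e1 e3 area; apply/negP.
by rewrite !mulf_neq0 ?expf_neq0 // dir_det_eq0 // eq_sym.
Qed.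

(* The k's are forced to be proportional to the Vandermonde kernel
   1 / prod_(j != i) [i j]; the area is then, up to a factor, 2 / prod [i i+2]. *)
Let area5 (p1 p2 p3 p4 p5 : option F) (k1 k2 k3 k4 k5 : F) :
  let d := @dir_det F in
  p2 != p3 -> p2 != p4 -> p2 != p5 -> p3 != p4 -> p3 != p5 -> p4 != p5 ->
  k2 * (d p2 p3 * d p2 p4 * d p2 p5) + k1 * (d p1 p3 * d p1 p4 * d p1 p5) = 0 ->
  k3 * (d p2 p3 * d p3 p4 * d p3 p5) - k1 * (d p1 p2 * d p1 p4 * d p1 p5) = 0 ->
  k4 * (d p2 p4 * d p3 p4 * d p4 p5) + k1 * (d p1 p2 * d p1 p3 * d p1 p5) = 0 ->
  k5 * (d p2 p5 * d p3 p5 * d p4 p5) - k1 * (d p1 p2 * d p1 p3 * d p1 p4) = 0 ->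
  k1 * k2 * d p1 p2 ^+ 3 + k1 * k3 * d p1 p3 ^+ 3 + k2 * k3 * d p2 p3 ^+ 3
    + k4 * k5 * d p4 p5 ^+ 3
  = 2%:R * k1 ^+ 2 * (d p1 p2 * d p1 p5) ^+ 2 * d p1 p3 * d p1 p4
    / (d p2 p4 * d p2 p5 * d p3 p5).
Proof.
move=> d n23 n24 n25 n34 n35 n45.
have solve (k c e : F) : c != 0 -> k * c + e = 0 -> k = - e / c.
  by move=> c0 h; apply: (mulIf c0); rewrite divfK //; apply/eqP; rewrite -addr_eq0 h.
have nz (p q : option F) : p != q -> d p q != 0 by rewrite dir_det_eq0.
move/nz: n23; move/nz: n24; move/nz: n25; move/nz: n34; move/nz: n35; move/nz: n45.
move=> n45 n35 n34 n25 n24 n23.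
move=> /solve->; last by rewrite !mulf_neq0.
move=> /solve->; last by rewrite !mulf_neq0.
move=> /solve->; last by rewrite !mulf_neq0.
move=> /solve->; last by rewrite !mulf_neq0.
rewrite /d /dir_det in n45 n35 n34 n25 n24 n23 *.
by field; rewrite n23 n24 n25 n34 n35 n45.
Qed.

Section FivePoints.

Variables (h1 h2 h3 h4 h5 : nat) (p1 p2 p3 p4 p5 : option F) (y1 y2 y3 y4 y5 : seq F).
Hypotheses (d1 : disp h1 p1 y1 y2) (d2 : disp h2 p2 y2 y3) (d3 : disp h3 p3 y3 y4)
  (d4 : disp h4 p4 y4 y5) (d5 : disp h5 p5 y5 y1).
Hypotheses (l1 : (h1 <= 1)%N) (l2 : (h2 <= 1)%N) (l3 : (h3 <= 1)%N)
  (l4 : (h4 <= 1)%N) (l5 : (h5 <= 1)%N).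

(** All cubic forms return to their values, and so does [Z]. In the area, products across the groups
    1, 2, 3 and 4, 5 drop out, as the two groups have opposite sums in the [(A, D)] plane. *)
Lemma five_points : exists k1 k2 k3 k4 k5,
  [/\ [/\ k1 != 0, k2 != 0, k3 != 0, k4 != 0 & k5 != 0],
   forall a b c,
    k1 * (dir_det p1 a * dir_det p1 b * dir_det p1 c) +
    k2 * (dir_det p2 a * dir_det p2 b * dir_det p2 c) +
    k3 * (dir_det p3 a * dir_det p3 b * dir_det p3 c) +
    k4 * (dir_det p4 a * dir_det p4 b * dir_det p4 c) +
    k5 * (dir_det p5 a * dir_det p5 b * dir_det p5 c) = 0
  & k1 * k2 * dir_det p1 p2 ^+ 3 + k1 * k3 * dir_det p1 p3 ^+ 3 +
    k2 * k3 * dir_det p2 p3 ^+ 3 + k4 * k5 * dir_det p4 p5 ^+ 3 = 0].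
Proof.
have [k1 [k1n A2 D2 Z2 L1]] := disp1_cubic d1 l1.
have [k2 [k2n A3 D3 Z3 L2]] := disp1_cubic d2 l2.
have [k3 [k3n A4 D4 Z4 L3]] := disp1_cubic d3 l3.
have [k4 [k4n A5 D5 Z5 L4]] := disp1_cubic d4 l4.
have [k5 [k5n A1 D1 Z1 L5]] := disp1_cubic d5 l5.
exists k1, k2, k3, k4, k5; split=> // [a b c|].
  apply: (@addrI _ (cubic a b c y1)); rewrite addr0 [RHS]L5 L4 L3 L2 L1; ring.
rewrite -!char3_cube_det //.
have e0 : k1 * dir0 p1 ^+ 3 + k2 * dir0 p2 ^+ 3 + k3 * dir0 p3 ^+ 3 +
    (k4 * dir0 p4 ^+ 3 + k5 * dir0 p5 ^+ 3) = 0.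
  by apply: (@addrI _ (crdA y1)); rewrite addr0 [RHS]A1 A5 A4 A3 A2; ring.
have e1 : k1 * dir1 p1 ^+ 3 + k2 * dir1 p2 ^+ 3 + k3 * dir1 p3 ^+ 3 +
    (k4 * dir1 p4 ^+ 3 + k5 * dir1 p5 ^+ 3) = 0.
  by apply: (@addrI _ (crdD y1)); rewrite addr0 [RHS]D1 D5 D4 D3 D2; ring.
have {}e0 : k4 * dir0 p4 ^+ 3 = - (k1 * dir0 p1 ^+ 3 + k2 * dir0 p2 ^+ 3 + k3 * dir0 p3 ^+ 3
    + k5 * dir0 p5 ^+ 3).
  by apply/eqP; rewrite -addr_eq0 -e0; apply/eqP; ring.
have {}e1 : k4 * dir1 p4 ^+ 3 = - (k1 * dir1 p1 ^+ 3 + k2 * dir1 p2 ^+ 3 + k3 * dir1 p3 ^+ 3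
    + k5 * dir1 p5 ^+ 3).
  by apply/eqP; rewrite -addr_eq0 -e1; apply/eqP; ring.
have : (crdZ y1 - crdZ y5) + (crdZ y5 - crdZ y1) = 0 by ring.
rewrite {1}Z1 Z5 Z4 Z3 Z2 !(D5, D4, D3, D2, A5, A4, A3, A2).
rewrite [k4 * k5 * _](_ : _ = k5 * dir1 p5 ^+ 3 * (k4 * dir0 p4 ^+ 3)
   - k5 * dir0 p5 ^+ 3 * (k4 * dir1 p4 ^+ 3)); last by ring.
rewrite e0 e1.
by move=> e; rewrite -[LHS]opprK -[RHS]oppr0 -[in RHS]e; ring.
Qed.

Hypotheses (n12 : p1 != p2) (n23 : p2 != p3) (n34 : p3 != p4) (n45 : p4 != p5)
  (n51 : p5 != p1).

(** If [p1 = p3], some cubic form vanishes at all directions of the chain but one, so the jump in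
    that direction would be zero. *)
Lemma five_points_neq : p1 != p3.
Proof.
have [k1 [k2 [k3 [k4 [k5 [[_ k2n _ k4n k5n] L _]]]]]] := five_points.
have det0 (v : option F) : dir_det v v = 0 by rewrite /dir_det subrr.
apply/eqP => p13; have := n34; rewrite -p13 => n14.
have n41 : p4 != p1 by rewrite eq_sym.
have n21 : p2 != p1 by rewrite eq_sym.
have n54 : p5 != p4 by rewrite eq_sym.
have [p24|n24] := eqVneq p2 p4.
  have n52 : p5 != p2 by rewrite p24.
  have := L p1 p2 p2; rewrite -p13 -p24 !det0 ?mul0r ?mulr0 ?mul0r ?mulr0 ?add0r => e.
  by have := nz3 k5n n51 n52 n52; rewrite e eqxx.
have [p25|n25] := eqVneq p2 p5.
  have n42 : p4 != p2 by rewrite eq_sym.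
  have := L p1 p2 p2; rewrite -p13 -p25 !det0 ?mul0r ?mulr0 ?mul0r ?mulr0 ?add0r ?addr0 => e.
  by have := nz3 k4n n41 n42 n42; rewrite e eqxx.
have := L p1 p4 p5; rewrite -p13 !det0 !(mul0r, mulr0, add0r, addr0) => e.
by have := nz3 k2n n21 n24 n25; rewrite e eqxx.
Qed.

(** Forms vanishing at three of the last four directions express the other coefficients through
    [k1]; the area is then the nonzero value in [area5]. *)
Lemma five_points_not_distinct : p1 != p3 -> p1 != p4 -> p2 != p4 -> p2 != p5 -> p3 != p5 -> False.
Proof.
have [k1 [k2 [k3 [k4 [k5 [[k1n k2n _ k4n k5n] L area]]]]]] := five_points.
have det0 (v : option F) : dir_det v v = 0 by rewrite /dir_det subrr.
move=> n13 n14 n24 n25 n35.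
have two : 2%:R != 0 :> F.
  by apply/eqP => t0; move/eqP: char3; rewrite -natr1 t0 add0r oner_eq0.
have e2 := L p3 p4 p5; have e3 := L p2 p4 p5; have e4 := L p2 p3 p5; have e5 := L p2 p3 p4.
rewrite !det0 !(mul0r, mulr0, addr0, add0r) in e2 e3 e4 e5.
have nz (p q : option F) : p != q -> dir_det p q != 0 by rewrite dir_det_eq0.
have n15 : p1 != p5 by rewrite eq_sym.
suff : 2%:R * k1 ^+ 2 * (dir_det p1 p2 * dir_det p1 p5) ^+ 2 * dir_det p1 p3 * dir_det p1 p4
    / (dir_det p2 p4 * dir_det p2 p5 * dir_det p3 p5) == 0.
  by apply/negP; rewrite !(mulf_neq0, expf_neq0, invr_neq0) ?nz.
rewrite -(@area5 p1 p2 p3 p4 p5 k1 k2 k3 k4 k5) ?area //.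
- by rewrite -[RHS]e2 addrC.
- by rewrite -[RHS]oppr0 -[in RHS]e3 (dir_detC p2 p3); ring.
- by rewrite -[RHS]e4 (dir_detC p2 p4) (dir_detC p3 p4); ring.
by rewrite -[RHS]oppr0 -[in RHS]e5 (dir_detC p2 p5) (dir_detC p3 p5) (dir_detC p4 p5); ring.
Qed.

End FivePoints.

(** Rotating the closed chain, [five_points_neq] separates all non-adjacent directions. *)
Lemma no_chain_1_1_1_1_1 h1 h2 h3 h4 h5 p1 p2 p3 p4 p5 y1 y2 y3 y4 y5 :
  disp h1 p1 y1 y2 -> disp h2 p2 y2 y3 -> disp h3 p3 y3 y4 ->
  disp h4 p4 y4 y5 -> disp h5 p5 y5 y1 ->
  (h1 <= 1)%N -> (h2 <= 1)%N -> (h3 <= 1)%N -> (h4 <= 1)%N -> (h5 <= 1)%N ->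
  p1 != p2 -> p2 != p3 -> p3 != p4 -> p4 != p5 -> p5 != p1 -> False.
Proof.
move=> d1 d2 d3 d4 d5 l1 l2 l3 l4 l5 n12 n23 n34 n45 n51.
apply: (five_points_not_distinct d1 d2 d3 d4 d5) => //.
- exact: (five_points_neq d1 d2 d3 d4 d5).
- by rewrite eq_sym; apply: (five_points_neq d4 d5 d1 d2 d3).
- exact: (five_points_neq d2 d3 d4 d5 d1).
- by rewrite eq_sym; apply: (five_points_neq d5 d1 d2 d3 d4).
exact: (five_points_neq d3 d4 d5 d1 d2).
Qed.

(** Up to rotation, the heights of two or more jumps of total at most 5 are dominated by [1 4],
    [2 3], [1 1 3], [1 2 2], [1 1 1 2] or [1 1 1 1 1]. *)
Lemma leaf5_chain_free : chain_free 0 5 leaf5.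
Proof.
move=> y s.
have sum5 h t : (0 < h + sumn t <= 5)%N -> (h <= 5)%N by lia.
case: s => [|[[p1 h1] z1] s] //= [g1 j1] c.
case: s c => [|[[p2 h2] z2] s] /=; first by rewrite eqxx.
move=> [g2 j2]; case: s => [|[[p3 h3] z3] s] /=.
  move=> ez sumh; rewrite {z2}ez in j2; rewrite andbT; apply/negP => /andP[n12 n21].
  have d1 : disp h1 p1 y z1 by apply: disp_of_jump => //; lia.
  have d2 : disp h2 p2 z1 y by apply: disp_of_jump => //; lia.
  have [l1|l1] := leqP h1 1; first exact: no_chain_1_4 d1 d2 l1 n12.
  have [l2|l2] := leqP h2 1; first exact: no_chain_1_4 d2 d1 l2 n21.
  have [l1'|l1'] := leqP h1 2; first by apply: no_chain_2_3 d1 d2 _ _ n12; lia.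
  by apply: no_chain_2_3 d2 d1 _ _ n21; lia.
move=> [g3 j3]; case: s => [|[[p4 h4] z4] s] /=.
  move=> ez sumh; rewrite {z3}ez in j3; rewrite andbT; apply/negP => /and3P[n12 n23 n31].
  have d1 : disp h1 p1 y z1 by apply: disp_of_jump => //; lia.
  have d2 : disp h2 p2 z1 z2 by apply: disp_of_jump => //; lia.
  have d3 : disp h3 p3 z2 y by apply: disp_of_jump => //; lia.
  have [l1|l1] := leqP h1 1; have [l2|l2] := leqP h2 1.
  - by apply: no_chain_1_1_3 d1 d2 d3 l1 l2 _ n12 n31; lia.
  - have [l3|l3] := leqP h3 1; first by apply: no_chain_1_1_3 d3 d1 d2 l3 l1 _ n31 n23; lia.
    by apply: no_chain_1_2_2 d1 d2 d3 l1 _ _ n12 n31; lia.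
  - have [l3|l3] := leqP h3 1; first by apply: no_chain_1_1_3 d2 d3 d1 l2 l3 _ n23 n12; lia.
    by apply: no_chain_1_2_2 d2 d3 d1 l2 _ _ n23 n12; lia.
  have l3 : (h3 <= 1)%N by lia.
  by apply: no_chain_1_2_2 d3 d1 d2 l3 _ _ n31 n23; lia.
move=> [g4 j4]; case: s => [|[[p5 h5] z5] s] /=.
  move=> ez sumh; rewrite {z4}ez in j4; rewrite andbT; apply/negP => /and4P[n12 n23 n34 n41].
  have d1 : disp h1 p1 y z1 by apply: disp_of_jump => //; lia.
  have d2 : disp h2 p2 z1 z2 by apply: disp_of_jump => //; lia.
  have d3 : disp h3 p3 z2 z3 by apply: disp_of_jump => //; lia.
  have d4 : disp h4 p4 z3 y by apply: disp_of_jump => //; lia.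
  have [l1|l1] := leqP h1 1; last by apply: no_chain_1_1_1_2 d2 d3 d4 d1 _ _ _ _ n23 n34 n41 n12; lia.
  have [l2|l2] := leqP h2 1; last by apply: no_chain_1_1_1_2 d3 d4 d1 d2 _ _ _ _ n34 n41 n12 n23; lia.
  have [l3|l3] := leqP h3 1; last by apply: no_chain_1_1_1_2 d4 d1 d2 d3 _ _ _ _ n41 n12 n23 n34; lia.
  by apply: no_chain_1_1_1_2 d1 d2 d3 d4 l1 l2 l3 _ n12 n23 n34 n41; lia.
move=> [g5 j5]; case: s => [|[[p6 h6] z6] s] /=; last by move=> [g6 _ _]; lia.
move=> ez sumh; rewrite {z5}ez in j5; rewrite andbT; apply/negP => /and5P[n12 n23 n34 n45 n51].
have d1 : disp h1 p1 y z1 by apply: disp_of_jump => //; lia.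
have d2 : disp h2 p2 z1 z2 by apply: disp_of_jump => //; lia.
have d3 : disp h3 p3 z2 z3 by apply: disp_of_jump => //; lia.
have d4 : disp h4 p4 z3 z4 by apply: disp_of_jump => //; lia.
have d5 : disp h5 p5 z4 y by apply: disp_of_jump => //; lia.
by apply: no_chain_1_1_1_1_1 d1 d2 d3 d4 d5 _ _ _ _ _ n12 n23 n34 n45 n51; lia.
Qed.

End Hexagon.

(** * The case [k = 2]: the projective plane *)

Section Plane.

Variable (F : fieldType).

(** The polarity of a symmetric bilinear form, on affine points; words of length at most 1 play the
    points at infinity. *)
Definition leaf2 : rel (seq F) := fun x y =>
  [&& size x == 2%N, size y == 2%N & x`_1 + y`_1 == x`_0 * y`_0].

Lemma seq2E (x : seq F) : size x = 2%N -> x = [:: x`_0; x`_1].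
Proof. by case: x => [|? [|? []]]. Qed.

Lemma leaf2_size x y : leaf2 x y -> size x = 2%N /\ size y = 2%N.
Proof. by case/and3P => /eqP-> /eqP->. Qed.

Lemma leaf2_sym : symmetric leaf2.
Proof. by move=> x y; rewrite /leaf2 andbCA addrC mulrC. Qed.

Lemma leaf2E x y : leaf2 x y -> y`_1 = x`_0 * y`_0 - x`_1.
Proof. by case/and3P => _ _ /eqP<-; rewrite [x`_1 + _]addrC addrK. Qed.

Lemma leaf2_inj x y y' : leaf2 x y -> leaf2 x y' -> y`_0 = y'`_0 -> y = y'.
Proof.
move=> xy xy' y0; have [_ sy] := leaf2_size xy; have [_ sy'] := leaf2_size xy'.
by rewrite (seq2E sy) (seq2E sy') (leaf2E xy) (leaf2E xy') y0.
Qed.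

Lemma jump2 p y y' : jump 0 2 leaf2 p 1 y y' ->
  exists2 k, k != 0 & y'`_0 = y`_0 + k * dir0 p /\ y'`_1 = y`_1 + k * dir1 p.
Proof.
move=> [sy sy' yy']; case: p => [a|] /=.
  move=> [x [x' [[xy x'y'] xa x'a tx]]].
  have xx' : x' = x.
    have [sx _] := leaf2_size xy; have [sx' _] := leaf2_size x'y'.
    by rewrite (seq2E sx) (seq2E sx') xa x'a (nth_take_eq (i := 1) tx).
  rewrite xx' in x'y'; exists (y'`_0 - y`_0).
    by rewrite subr_eq0; apply: contra_neq yy' => e; rewrite -(leaf2_inj x'y' xy e).
  by rewrite (leaf2E xy) (leaf2E x'y') xa; split; ring.
move=> ty; have y0 : y'`_0 = y`_0 by apply: (@nth_take_eq _ y' y 1).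
exists (y'`_1 - y`_1); last by rewrite y0; split; ring.
by rewrite subr_eq0; apply: contra_neq yy' => e; rewrite (seq2E sy) (seq2E sy') y0 e.
Qed.

Lemma leaf2_chain_free : chain_free 0 2 leaf2.
Proof.
move=> y s.
case: s => [|[[p1 h1] z1] s] //= [g1 j1] c.
case: s c => [|[[p2 h2] z2] s] /=; first by rewrite eqxx.
move=> [g2 j2]; case: s => [|[[p3 h3] z3] s] /=; last by move=> [g3 _ _]; lia.
move=> ez sumh; rewrite {z2}ez in j2; rewrite andbT; apply/negP => /andP[n12 _].
have h1E : h1 = 1%N by lia.
have h2E : h2 = 1%N by lia.
rewrite h1E in j1; rewrite h2E in j2.
have [k1 k1n [e0 e1]] := jump2 j1; have [k2 _ [f0 f1]] := jump2 j2.
have : k1 * dir_det p1 p2 == 0.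
  have {}e0 : k1 * dir0 p1 + k2 * dir0 p2 = 0.
    by apply: (@addrI _ y`_0); rewrite addr0 [RHS]f0 e0; ring.
  have {}e1 : k1 * dir1 p1 + k2 * dir1 p2 = 0.
    by apply: (@addrI _ y`_1); rewrite addr0 [RHS]f1 e1; ring.
  rewrite (_ : k1 * _ = dir1 p2 * (k1 * dir0 p1 + k2 * dir0 p2)
    - dir0 p2 * (k1 * dir1 p1 + k2 * dir1 p2)); last by rewrite /dir_det; ring.
  by rewrite e0 e1 !mulr0 subrr.
by rewrite mulf_eq0 (negbTE k1n) dir_det_eq0 (negbTE n12).
Qed.

End Plane.

(** * The case [k = 3]: the symplectic quadrangle *)

Section Quadrangle.

Variables (F : fieldType) (sigma : {rmorphism F -> F}).
Hypothesis char2 : 2%:R = 0 :> F.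
Hypothesis sigma2 : forall x, sigma (sigma x) = x ^+ 2.

(* Self-polar form of the symplectic quadrangle in coordinates. *)
Definition leaf3 : rel (seq F) := fun x y =>
  [&& size x == 3%N, size y == 3%N,
      x`_2 + y`_1 == x`_0 * sigma y`_0 & x`_1 + y`_2 == sigma x`_0 * y`_0].

Lemma seq3E (x : seq F) : size x = 3%N -> x = [:: x`_0; x`_1; x`_2].
Proof. by case: x => [|? [|? [|? []]]]. Qed.

Lemma leaf3_size x y : leaf3 x y -> size x = 3%N /\ size y = 3%N.
Proof. by case/and3P => /eqP-> /eqP->. Qed.

Lemma leaf3_sym : symmetric leaf3.
Proof.
move=> x y; rewrite /leaf3 andbCA; congr [&& _, _ & _].
rewrite [y`_2 + _]addrC [y`_1 + _]addrC [y`_0 * sigma _]mulrC [sigma y`_0 * _]mulrC.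
exact: andbC.
Qed.

Lemma leaf3E x y : leaf3 x y ->
  y`_1 = x`_0 * sigma y`_0 - x`_2 /\ y`_2 = sigma x`_0 * y`_0 - x`_1.
Proof.
case/and3P => _ _ /andP[/eqP<- /eqP<-].
by rewrite ![x`__ + _]addrC !addrK.
Qed.

Lemma leaf3_inj x y y' : leaf3 x y -> leaf3 x y' -> y`_0 = y'`_0 -> y = y'.
Proof.
move=> xy xy' y0; have [_ sy] := leaf3_size xy; have [_ sy'] := leaf3_size xy'.
have [e1 e2] := leaf3E xy; have [f1 f2] := leaf3E xy'.
by rewrite (seq3E sy) (seq3E sy') e1 e2 f1 f2 y0.
Qed.

(** In the coordinates [(sigma y_0, y_1, sigma y_2)] height 1 moves along a point [(s^2, s t, t^2)]
    of a conic. Height 2 leaves [y_1] free: in characteristic 2 all tangents pass through the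
    nucleus [(0, 1, 0)]. *)
Lemma jump3 p h y y' : (0 < h <= 2)%N -> jump 0 3 leaf3 p h y y' ->
  exists k, [/\ sigma y'`_0 = sigma y`_0 + k * dir0 p ^+ 2,
    sigma y'`_2 = sigma y`_2 + k * dir1 p ^+ 2
  & (h <= 1)%N -> k != 0 /\ y'`_1 = y`_1 + k * (dir0 p * dir1 p)].
Proof.
move=> /andP[h0 h2] [sy sy' yy'].
have inj : sigma y`_0 = sigma y'`_0 -> y`_1 = y'`_1 -> sigma y`_2 = sigma y'`_2 -> False.
  move=> /fmorph_inj e0 e1 /fmorph_inj e2; case/eqP: yy'.
  by rewrite (seq3E sy) (seq3E sy') e0 e1 e2.
case: p => [a|] /=.
  move=> [x [x' [[xy x'y'] xa x'a tx]]].
  have nt i : (i < 3 - h.-1)%N -> x`_i = x'`_i by apply: nth_take_eq.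
  have [e1 e2] := leaf3E xy; have [f1 f2] := leaf3E x'y'; rewrite xa in e1 e2; rewrite x'a in f1 f2.
  have x1 : x`_1 = x'`_1 by apply: nt; lia.
  exists (sigma y'`_0 - sigma y`_0); split.
  - by ring.
  - by rewrite e2 f2 x1 !rmorphB !rmorphM sigma2; ring.
  move=> h1; have x2 : x`_2 = x'`_2 by apply: nt; lia.
  split; last by rewrite e1 f1 x2; ring.
  rewrite subr_eq0; apply/eqP => y0; apply: inj; rewrite // ?e1 ?f1 ?e2 ?f2 ?x1 ?x2 ?y0 //.
  by rewrite (fmorph_inj _ y0).
move=> ty; have nt i : (i < 3 - h)%N -> y`_i = y'`_i by apply: nth_take_eq.
have y0 : y`_0 = y'`_0 by apply: nt; lia.
exists (sigma y'`_2 - sigma y`_2); split; [by rewrite y0; ring|by ring|].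
move=> h1; have y1 : y`_1 = y'`_1 by apply: nt; lia.
split; last by rewrite y1; ring.
by rewrite subr_eq0; apply/eqP => y2; apply: inj; rewrite ?y0.
Qed.

Lemma no_chain3_1_2 h1 h2 p q y1 y2 : jump 0 3 leaf3 p h1 y1 y2 -> jump 0 3 leaf3 q h2 y2 y1 ->
  h1 = 1%N -> (0 < h2 <= 2)%N -> p != q -> False.
Proof.
move=> j1 j2 h1E hle2 pq; rewrite h1E in j1.
have [k1 [A1 D1 /(_ isT)[k1n _]]] := jump3 (isT : (0 < 1 <= 2)%N) j1.
have [k2 [A2 D2 _]] := jump3 hle2 j2.
have : k1 * dir_det p q ^+ 2 == 0.
  have {}A1 : k1 * dir0 p ^+ 2 + k2 * dir0 q ^+ 2 = 0.
    by apply: (@addrI _ (sigma y1`_0)); rewrite addr0 [RHS]A2 A1; ring.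
  have {}D1 : k1 * dir1 p ^+ 2 + k2 * dir1 q ^+ 2 = 0.
    by apply: (@addrI _ (sigma y1`_2)); rewrite addr0 [RHS]D2 D1; ring.
  rewrite (_ : k1 * _ = dir1 q ^+ 2 * (k1 * dir0 p ^+ 2 + k2 * dir0 q ^+ 2)
    - dir0 q ^+ 2 * (k1 * dir1 p ^+ 2 + k2 * dir1 q ^+ 2)
    + 2%:R * (k1 * (dir0 q ^+ 2 * dir1 p ^+ 2 - dir0 p * dir1 q * dir0 q * dir1 p)));
    last by rewrite /dir_det; ring.
  by rewrite A1 D1 char2 !mulr0 mul0r subrr addr0.
by rewrite mulf_eq0 (negbTE k1n) expf_eq0 /= dir_det_eq0 (negbTE pq).
Qed.

Lemma leaf3_chain_free : chain_free 0 3 leaf3.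
Proof.
move=> y s.
case: s => [|[[p1 h1] z1] s] //= [g1 j1] c.
case: s c => [|[[p2 h2] z2] s] /=; first by rewrite eqxx.
move=> [g2 j2]; case: s => [|[[p3 h3] z3] s] /=.
  move=> ez sumh; rewrite {z2}ez in j2; rewrite andbT; apply/negP => /andP[n12 n21].
  have [l1|l1] := eqVneq h1 1%N; first by apply: no_chain3_1_2 j1 j2 l1 _ n12; lia.
  by apply: no_chain3_1_2 j2 j1 _ _ n21; lia.
move=> [g3 j3]; case: s => [|[[p4 h4] z4] s] /=; last by move=> [g4 _ _]; lia.
move=> ez sumh; rewrite {z3}ez in j3; rewrite andbT; apply/negP => /and3P[n12 n23 n31].
have h1E : h1 = 1%N by lia.
have h2E : h2 = 1%N by lia.
have h3E : h3 = 1%N by lia.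
rewrite h1E in j1; rewrite h2E in j2; rewrite h3E in j3.
have [k1 [A1 D1 /(_ isT)[k1n B1]]] := jump3 (isT : (0 < 1 <= 2)%N) j1.
have [k2 [A2 D2 /(_ isT)[_ B2]]] := jump3 (isT : (0 < 1 <= 2)%N) j2.
have [k3 [A3 D3 /(_ isT)[_ B3]]] := jump3 (isT : (0 < 1 <= 2)%N) j3.
have {}A1 : k1 * dir0 p1 ^+ 2 + k2 * dir0 p2 ^+ 2 + k3 * dir0 p3 ^+ 2 = 0.
  by apply: (@addrI _ (sigma y`_0)); rewrite addr0 [RHS]A3 A2 A1; ring.
have {}B1 : k1 * (dir0 p1 * dir1 p1) + k2 * (dir0 p2 * dir1 p2) + k3 * (dir0 p3 * dir1 p3) = 0.
  by apply: (@addrI _ y`_1); rewrite addr0 [RHS]B3 B2 B1; ring.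
have {}D1 : k1 * dir1 p1 ^+ 2 + k2 * dir1 p2 ^+ 2 + k3 * dir1 p3 ^+ 2 = 0.
  by apply: (@addrI _ (sigma y`_2)); rewrite addr0 [RHS]D3 D2 D1; ring.
(* The quadratic form with zeros at [p2] and [p3] isolates the first jump. *)
have : k1 * (dir_det p1 p2 * dir_det p1 p3) == 0.
  rewrite (_ : _ * _ =
    dir1 p2 * dir1 p3 * (k1 * dir0 p1 ^+ 2 + k2 * dir0 p2 ^+ 2 + k3 * dir0 p3 ^+ 2)
    - (dir0 p2 * dir1 p3 + dir1 p2 * dir0 p3) *
      (k1 * (dir0 p1 * dir1 p1) + k2 * (dir0 p2 * dir1 p2) + k3 * (dir0 p3 * dir1 p3))
    + dir0 p2 * dir0 p3 * (k1 * dir1 p1 ^+ 2 + k2 * dir1 p2 ^+ 2 + k3 * dir1 p3 ^+ 2));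
    last by rewrite /dir_det; ring.
  by rewrite A1 B1 D1 !mulr0 subrr addr0.
apply/negP; rewrite !mulf_neq0 // dir_det_eq0 //.
by rewrite eq_sym.
Qed.

End Quadrangle.

(** * The lower bound *)

Section LowerNumeric.

Variable (R : realType).

(** For [t = n^(1/k)], Bernoulli gives [u ^ k > n], hence [t <= u = q + 1/k + 3/(4q)]. Inserting
    [u], and [q + 1] in the last quotient, the terms [n / k] cancel and
    [1 + q^(k-1) <= n (2/(q+1) - 3/(4q))] remains; this follows from [n >= q ^ k] and [q >= 15]. *)
Lemma lower_numeric (k q n : nat) : (2 <= k)%N -> (15 <= q)%N ->
  (n * q.-1 + 1 = q ^ k.+1)%N ->
  n%:R * n%:R `^ k%:R^-1 + (k%:R - 1) / k%:R * n%:R - 2 * (n%:R / n%:R `^ k%:R^-1)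
    <= 2 * (n%:R - 1) + q%:R ^+ k.+1 - q%:R ^+ k.-1 :> R.
Proof.
move=> k2 q15 nE.
have k0 : (0 < k)%N by apply: ltnW.
have q0 : (0 < q)%N by apply: leq_trans q15.
have n0 : (0 < n)%N.
  rewrite lt0n; apply/eqP => n0; move: nE; rewrite n0 mul0n add0n => e.
  by have := ltn_expl k.+1 (leq_trans _ q15 : (1 < q)%N); rewrite -e; lia.
have {}nE : n%:R * (q%:R - 1) + 1 = q%:R ^+ k.+1 :> R.
  by rewrite -natrX -nE natrD natrM -subn1 natrB.
have tk := @powR_inv_expn R k n k0; have t1 := @ge1_powR_inv R k n n0.
move: tk t1; set t := n%:R `^ k%:R^-1 => tk t1.
have kR : 2 <= k%:R :> R by rewrite ler_nat.
have {}q15 : 15%:R <= q%:R :> R by rewrite ler_nat.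
have bern (x : R) : -1 <= x -> 1 + k%:R * x <= (1 + x) ^+ k by exact: bernoulli_ineq.
move: n%:R k%:R q%:R nE tk kR q15 bern => N K Q nE tk kR q15 bern.
pose m := Q ^+ k.-1.
have m15 : 15%:R <= m.
  have Q1 : 1 <= Q by lra.
  have k1 : (1 <= k.-1)%N by rewrite -subn1 leq_subRL.
  by apply: le_trans q15 _; have := ler_weXn2l Q1 k1; rewrite expr1.
have qk : Q ^+ k = Q * m by rewrite /m -exprS prednK.
have qk1 : Q ^+ k.+1 = Q * (Q * m) by rewrite exprS qk.
have Nq : Q * m <= N.
  by rewrite -(ler_pM2r (_ : 0 < Q - 1)); [rewrite qk1 in nE; nra|lra].
have kinv : K^-1 <= 2^-1 by rewrite lef_pV2 ?posrE; lra.
have kinv0 : 0 < K^-1 by rewrite invr_gt0; lra.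
have qinv : Q^-1 <= 15%:R^-1 by rewrite lef_pV2 ?posrE; lra.
have qinv0 : 0 < Q^-1 by rewrite invr_gt0; lra.
pose u := Q + K^-1 + 3 / 4 * Q^-1.
have Q0 : Q != 0 by lra.
have K0 : K != 0 by lra.
have tu : t <= u.
  rewrite leNgt; apply/negP => ut.
  have u0 : 0 <= u by rewrite /u; lra.
  have : u ^+ k <= t ^+ k by rewrite lerXn2r ?nnegrE ?(ltW ut) //; lra.
  rewrite tk; apply/negP; rewrite -ltNge.
  have z1 : -1 <= (K^-1 + 3 / 4 * Q^-1) / Q.
    by apply: (@le_trans _ _ 0); [lra|rewrite divr_ge0; lra].
  have := bern _ z1; rewrite (_ : K * _ = Q^-1 * (1 + 3 / 4 * K * Q^-1)); last by field; rewrite Q0 K0.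
  move=> {}bern.
  have -> : u = Q * (1 + (K^-1 + 3 / 4 * Q^-1) / Q) by rewrite /u; field; rewrite Q0 K0.
  rewrite exprMn qk; apply: lt_le_trans (ler_wpM2l _ bern); last by nra.
  have m0 : 0 < m by lra.
  have KQ : 3 / 2 * Q^-1 <= 3 / 4 * K * Q^-1 by rewrite ler_pM2r //; lra.
  apply: (@lt_le_trans _ _ (Q * m * (1 + Q^-1 * (1 + 3 / 2 * Q^-1)))); last first.
    rewrite ler_pM2l ?mulr_gt0 //; last lra.
    by rewrite lerD2l ler_pM2l // lerD2l.
  rewrite -(ltr_pM2r (_ : 0 < Q - 1)); last lra.
  rewrite (_ : _ * _ * (Q - 1) = m * (Q ^+ 2 + 2^-1 - 3 / 2 * Q^-1)); last by field.
  rewrite (_ : N * (Q - 1) = Q * (Q * m) - 1); last by rewrite -qk1 -nE; ring.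
  have : 0 <= m * (2^-1 - 3 / 2 * Q^-1) by rewrite mulr_ge0; lra.
  by rewrite !mulrDr mulrN; lra.
have u1 : u <= Q + 1 by rewrite /u; lra.
have t0 : 0 < t by lra.
have N0 : 0 < N by nra.
have Ntu : N * t <= N * u by rewrite ler_pM2l.
have Nt : N / (Q + 1) <= N / t.
  by rewrite ler_pM2l // lef_pV2 ?posrE //; lra.
rewrite qk1 -/m (_ : Q * (Q * m) = N * (Q - 1) + 1); last by rewrite nE.
have N1 : Q * m * (2 / (Q + 1) - 3 / 4 * Q^-1) <= N * (2 / (Q + 1) - 3 / 4 * Q^-1).
  rewrite ler_wpM2r // subr_ge0; apply: (@le_trans _ _ Q^-1); first by lra.
  by rewrite ler_pdivlMr ?mulrDr ?mulVf //; lra.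
have M1 : 1 + m <= Q * m * (2 / (Q + 1) - 3 / 4 * Q^-1).
  rewrite (_ : Q * m * _ = m * (2 * (1 - (Q + 1)^-1) - 3 / 4)); last by field; rewrite Q0 /=; lra.
  have qi : (Q + 1)^-1 <= 16%:R^-1 by rewrite lef_pV2 ?posrE; lra.
  have : m * (9 / 8) <= m * (2 * (1 - (Q + 1)^-1) - 3 / 4) by rewrite ler_pM2l; lra.
  by lra.
have -> : (K - 1) / K * N = N - N * K^-1 by field.
move: Ntu N1 Nt; rewrite /u; set a := N / t; set b := N * t.
rewrite (_ : N * (2 / (Q + 1) - 3 / 4 * Q^-1) = 2 * (N / (Q + 1)) - 3 / 4 * (N * Q^-1)); last by ring.
rewrite (_ : N * (Q + K^-1 + 3 / 4 * Q^-1) = N * Q + N * K^-1 + 3 / 4 * (N * Q^-1)); last by ring.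
by lra.
Qed.

End LowerNumeric.

Lemma frobenius_iter (F : finFieldType) (p m : nat) : p \in [pchar F] ->
  exists sigma : {rmorphism F -> F}, forall x, sigma x = x ^+ (p ^ m).
Proof.
move=> chF; elim: m => [|m [s sE]]; first by exists idfun => x; rewrite expr1.
exists (pFrobenius_aut chF \o s) => x /=.
by rewrite pFrobenius_autE sE -exprM expnSr.
Qed.

(* On a field with p^(2e+1) elements, x |-> x^(p^(e+1)) is a square root of
   the Frobenius endomorphism. *)
Lemma frobenius_root (p e : nat) : prime p ->
  exists F : finFieldType, [/\ #|F| = (p ^ e.*2.+1)%N, p%:R = 0 :> F &
    exists sigma : {rmorphism F -> F}, forall x, sigma (sigma x) = x ^+ p].
Proof.
move=> pp; have [F chF cF] := @finfield.pPrimePowerField p e.*2.+1 pp isT.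
exists F; split=> //; first by case/andP: chF => _ /eqP.
have [s sE] := @frobenius_iter F p e.+1 chF; exists s => x.
rewrite !sE -exprM -expnD (_ : (e.+1 + e.+1)%N = e.*2.+1.+1); last by lia.
by rewrite expnSr exprM -cF finfield.expf_card.
Qed.

(** * The three families of extremal graphs *)

Section Instances.

Variable F : finFieldType.

Lemma ex_leaf2 : 2%:R != 0 :> F ->
  exists n, [/\ (n * #|F|.-1 + 1 = #|F| ^ 3)%N &
  (2 * (n - 1) + #|F| ^ 3 - #|F| ^ 1 <=
    2 * ex n (even_cycles 2 `|` short_cycles 2)%classic)%N].
Proof.
move=> two; apply: (@ex_tree_graph F 0 2 (@leaf2 F)) => //.
- exact: leaf2_size.
- exact: leaf2_sym.
- exact: leaf2_inj.
- move=> x c sx; exists [:: c; x`_0 * c - x`_1] => //.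
  by rewrite /leaf2 sx /= addrC subrK.
- move=> x y lx ly txy; have [sx _] := leaf2_size lx; have [sy _] := leaf2_size ly.
  have xy0 : x`_0 = y`_0 by apply: nth_take_eq txy _.
  (* A self-related leaf has [2 x_1 = x_0 ^ 2], which determines [x_1] as 2 is invertible. *)
  rewrite (seq2E sx) (seq2E sy) xy0; congr [:: _; _]; apply: (mulfI two).
  case/and3P: lx => _ _ /eqP lx; case/and3P: ly => _ _ /eqP ly.
  by rewrite !mulr_natl !mulr2n lx ly xy0.
exact: leaf2_chain_free.
Qed.

Variable sigma : {rmorphism F -> F}.

Lemma ex_leaf3 : 2%:R = 0 :> F -> (forall x, sigma (sigma x) = x ^+ 2) ->
  exists n, [/\ (n * #|F|.-1 + 1 = #|F| ^ 4)%N &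
  (2 * (n - 1) + #|F| ^ 4 - #|F| ^ 2 <=
    2 * ex n (even_cycles 3 `|` short_cycles 3)%classic)%N].
Proof.
move=> two s2; apply: (@ex_tree_graph F 0 3 (leaf3 sigma)) => //.
- exact: leaf3_size.
- exact: leaf3_sym.
- exact: leaf3_inj.
- move=> x c sx; exists [:: c; x`_0 * sigma c - x`_2; sigma x`_0 * c - x`_1] => //.
  by rewrite /leaf3 sx /= [x`_2 + _]addrC [x`_1 + _]addrC !subrK !eqxx.
- move=> x y lx ly txy; have [sx _] := leaf3_size lx; have [sy _] := leaf3_size ly.
  have xy i : (i < 2)%N -> x`_i = y`_i by move=> i2; apply: nth_take_eq txy _.
  have xy0 := xy 0%N isT; have xy1 := xy 1%N isT.
  rewrite (seq3E sx) (seq3E sy) xy0 xy1; congr [:: _; _; _].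
  case/and4P: lx => _ _ /eqP lx _; case/and4P: ly => _ _ /eqP ly _.
  by apply: (addIr y`_1); rewrite ly -{1}xy1 lx xy0.
exact: leaf3_chain_free.
Qed.

Lemma ex_leaf5 : 3%:R = 0 :> F -> (forall x, sigma (sigma x) = x ^+ 3) ->
  exists n, [/\ (n * #|F|.-1 + 1 = #|F| ^ 6)%N &
  (2 * (n - 1) + #|F| ^ 6 - #|F| ^ 4 <=
    2 * ex n (even_cycles 5 `|` short_cycles 5)%classic)%N].
Proof.
move=> three s2; apply: (@ex_tree_graph F 0 5 (leaf5 sigma)) => //.
- exact: leaf5_size.
- exact: leaf5_sym.
- exact: leaf5_inj.
- move=> x c sx; pose y1 := x`_0 * sigma c - x`_4.
  exists [:: c; y1; sigma x`_0 * c ^+ 2 + c * x`_1 - x`_3;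
    x`_0 ^+ 2 * sigma c + x`_0 * y1 - x`_2; sigma x`_0 * c - x`_1] => //.
  by rewrite /leaf5 sx /= /y1 [x`_4 + _]addrC [x`_1 + _]addrC [x`_2 + _]addrC [x`_3 + _]addrC
    !subrK !eqxx.
- move=> x y lx ly txy; have [sx _] := leaf5_size lx; have [sy _] := leaf5_size ly.
  have xy i : (i < 4)%N -> x`_i = y`_i by move=> i4; apply: nth_take_eq txy _.
  have xy0 := xy 0%N isT; have xy1 := xy 1%N isT.
  rewrite (seq5E sx) (seq5E sy) xy0 xy1 (xy 2%N) // (xy 3%N) //; congr [:: _; _; _; _; _].
  case/and4P: lx => _ _ /eqP lx _; case/and4P: ly => _ _ /eqP ly _.
  by apply: (addIr y`_1); rewrite ly -{1}xy1 lx xy0.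
exact: leaf5_chain_free.
Qed.

End Instances.

Lemma lower_bound_of_ex (R : realType) (k q n x : nat) : (2 <= k)%N -> (15 <= q)%N ->
  (n * q.-1 + 1 = q ^ k.+1)%N -> (2 * (n - 1) + q ^ k.+1 - q ^ k.-1 <= 2 * x)%N ->
  2^-1 * n%:R `^ (1 + k%:R^-1) + (k%:R - 1) / (2 * k%:R) * n%:R
       - n%:R `^ (1 - k%:R^-1) <= x%:R :> R.
Proof.
move=> k2 q15 nE xle; have n0 : (0 < n)%N.
  have q0 : (1 < q)%N by apply: leq_trans q15.
  rewrite lt0n; apply/eqP => n0; have := ltn_expl k.+1 q0.
  by rewrite -nE n0 mul0n; lia.
have := lower_numeric R k2 q15 nE; rewrite powR_1Dinv ?powR_1Binv //.
have {}xle : 2 * (n%:R - 1) + q%:R ^+ k.+1 - q%:R ^+ k.-1 <= 2 * x%:R :> R.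
  have : (2 * n + q ^ k.+1 <= 2 * x + q ^ k.-1 + 2)%N by move: xle n0; clear; lia.
  by rewrite -(ler_nat R) (natrD _ (2 * n)) (natrD _ _ 2) (natrD _ (2 * x)) !natrM !natrX; lra.
move=> /le_trans/(_ xle) h; have k0 : k%:R != 0 :> R by rewrite pnatr_eq0 -lt0n ltnW.
have t0 : n%:R `^ k%:R^-1 != 0 :> R by rewrite lt0r_neq0 // powR_gt0 // ltr0n.
rewrite -(ler_pM2l (_ : 0 < 2)) //; apply: le_trans h.
by rewrite le_eqVlt; apply/orP; left; apply/eqP; field; rewrite t0 k0.
Qed.

(** [n < q] would give [n (q - 1) + 1 < q ^ 2]. *)
Lemma lower_order (q n k N : nat) : (2 <= k)%N -> (1 < q)%N -> (N < q)%N ->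
  (n * q.-1 + 1 = q ^ k.+1)%N -> (N <= n)%N.
Proof.
move=> k2 q1 Nq nE; apply: leq_trans (ltnW Nq) _; rewrite leqNgt; apply/negP => nq.
have : (q ^ 2 <= q ^ k.+1)%N by rewrite leq_pexp2l // ltnW // ltnS.
rewrite -nE -mulnn; case: q q1 nq {Nq nE} => // q q1 nq /=.
by nia.
Qed.

Local Open Scope classical_set_scope.
Local Open Scope ring_scope.

Theorem theorem5p7 (R : realType) (k : nat) (hk : (2 <= k)%N) :
  (forall n : nat, (1 <= n)%N ->
     (ex n (even_cycles k `|` short_cycles k))%:R <=
       2^-1 * n%:R `^ (1 + k%:R^-1) + (k%:R - 1) / (2 * k%:R) * n%:R
       + n%:R `^ (1 - k%:R^-1) :> R)
  /\
  (k \in [:: 2; 3; 5]%N ->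
     forall N : nat, exists n : nat, (N <= n)%N /\
       2^-1 * n%:R `^ (1 + k%:R^-1) + (k%:R - 1) / (2 * k%:R) * n%:R
       - n%:R `^ (1 - k%:R^-1)
       <= (ex n (even_cycles k `|` short_cycles k))%:R :> R).
Proof.
split=> [n n1|k235 N]; first exact: ex_upper_bound.
(* The exponent is odd, as [frobenius_root] requires, and at least 5, so that [q >= 32]; it also
   exceeds [N]. *)
have big p : (1 < p)%N -> (N + 5 < p ^ (N + 2).*2.+1)%N /\ (15 <= p ^ (N + 2).*2.+1)%N.
  move=> p1; have := ltn_expl (N + 2).*2.+1 p1; split; first by lia.
  apply: leq_trans (_ : 2 ^ 5 <= _)%N => //.
  by apply: leq_trans (leq_pexp2l _ (_ : 5 <= (N + 2).*2.+1)%N) _; rewrite ?leq_exp2r //; lia.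
suff [n [q [qN q15 nE xle]]] : exists n q, [/\ (N < q)%N, (15 <= q)%N,
    (n * q.-1 + 1 = q ^ k.+1)%N & (2 * (n - 1) + q ^ k.+1 - q ^ k.-1 <=
      2 * ex n (even_cycles k `|` short_cycles k))%N].
  by exists n; split; [apply: lower_order nE => //; apply: leq_trans q15|apply: lower_bound_of_ex nE xle].
have step p (F : finFieldType) n : (1 < p)%N -> #|F| = (p ^ (N + 2).*2.+1)%N ->
    [/\ (n * #|F|.-1 + 1 = #|F| ^ k.+1)%N & (2 * (n - 1) + #|F| ^ k.+1 - #|F| ^ k.-1 <=
      2 * ex n (even_cycles k `|` short_cycles k))%N] ->
    exists n q, [/\ (N < q)%N, (15 <= q)%N,
    (n * q.-1 + 1 = q ^ k.+1)%N & (2 * (n - 1) + q ^ k.+1 - q ^ k.-1 <=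
      2 * ex n (even_cycles k `|` short_cycles k))%N].
  move=> p1 cF [nE xle]; exists n, #|F|; split=> //; rewrite cF; have [] := big p p1 => //.
  by lia.
move: k235 step; rewrite !inE => /or3P[] /eqP-> step.
- have [F [cF c3 _]] := @frobenius_root 3 (N + 2) isT.
  have two : 2%:R != 0 :> F.
    by apply/eqP => t0; move/eqP: c3; rewrite -natr1 t0 add0r oner_eq0.
  by have [n nP] := ex_leaf2 two; apply: step cF nP.
- have [F [cF c2 [s s2]]] := @frobenius_root 2 (N + 2) isT.
  by have [n nP] := ex_leaf3 c2 s2; apply: step cF nP.
have [F [cF c3 [s s2]]] := @frobenius_root 3 (N + 2) isT.
by have [n nP] := ex_leaf5 c3 s2; apply: step cF nP.
Qed.
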